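(* Let $m\geqslant 0$ be an integer. The elements $$\mathrm{tr}\,D^{-1}\big((L^+)^{-1}L^-\big)^m,\qquad \mathrm{tr}\,D^{-1}\big((L^-)^{-1}L^+\big)^m,\qquad \mathrm{tr}\,D\big(L^+(L^-)^{-1}\big)^m$$ belong to the center of $\mathrm{U}_q(\mathfrak{gl}_n)$, and $$\mathrm{tr}\,D^{-1}\big((L^+)^{-1}L^-\big)^m=\mathrm{tr}\,D\big(L^-(L^+)^{-1}\big)^m,\qquad \mathrm{tr}\,D^{-1}\big((L^-)^{-1}L^+\big)^m=\mathrm{tr}\,D\big(L^+(L^-)^{-1}\big)^m .$$ Moreover, for any $n$-tuple $\lambda=(\lambda_1,\dots,\lambda_n)$ of integers (or real numbers), with $\ell_i=\lambda_i+n-i$, the element $\mathrm{tr}\,D(L^+(L^-)^{-1})^m$ acts in the irreducible highest weight representation $L_q(\lambda)$ as multiplication by the scalar $$\sum_{k=1}^n q^{-2\ell_k m}\,\prod_{\substack{1\leqslant i\leqslant n\\ i\neq k}}\frac{[\ell_i-\ell_k+1]_q}{[\ell_i-\ell_k]_q}.$$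
   Context: Throughout, $q$ is a nonzero complex number which is not a root of unity. For real $\lambda_i$ the powers $q^{a}$ are defined by $q^a=e^{a\log q}$ with a fixed choice of $\log q$. The $q$-numbers are $[k]_q=\dfrac{q^k-q^{-k}}{q-q^{-1}}$. Let $e_{ij}\in\mathrm{End}\,\mathbb{C}^n$ be the standard matrix units and $$R=q\sum_i e_{ii}\otimes e_{ii}+\sum_{i\neq j}e_{ii}\otimes e_{jj}+(q-q^{-1})\sum_{i<j}e_{ij}\otimes e_{ji}\in \mathrm{End}\,\mathbb{C}^n\otimes\mathrm{End}\,\mathbb{C}^n.$$ The quantized enveloping algebra $\mathrm{U}_q(\mathfrak{gl}_n)$ is the unital associative algebra over $\mathbb{C}$ generated by $l^+_{ij}$ and $l^-_{ij}$, $1\leqslant i,j\leqslant n$, subject to $$l^-_{ij}=l^+_{ji}=0\ (1\leqslant i<j\leqslant n),\qquad l^-_{ii}l^+_{ii}=l^+_{ii}l^-_{ii}=1\ (1\leqslant i\leqslant n),$$ $$R\,L^{\pm}_1L^{\pm}_2=L^{\pm}_2L^{\pm}_1R,\qquad R\,L^+_1L^-_2=L^-_2L^+_1R,$$ where $L^{\pm}=\sum_{i,j}e_{ij}\otimes l^{\pm}_{ij}\in \mathrm{End}\,\mathbb{C}^n\otimes \mathrm{U}_q(\mathfrak{gl}_n)$, and $L^\pm_1,L^\pm_2$ denote the copies of $L^{\pm}$ in $\mathrm{End}\,\mathbb{C}^n\otimes\mathrm{End}\,\mathbb{C}^n\otimes \mathrm{U}_q(\mathfrak{gl}_n)$ whose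 matrix part lies in the first, respectively second, tensor factor. The matrices $L^{\pm}$ are triangular with invertible diagonal entries, hence invertible. Set $D=\mathrm{diag}[q^{n-1},q^{n-3},\dots,q^{-n+1}]$. All traces are over $\mathrm{End}\,\mathbb{C}^n$. The representation $L_q(\lambda)$ is the irreducible representation of $\mathrm{U}_q(\mathfrak{gl}_n)$ generated by a nonzero vector $\xi$ such that $l^+_{ij}\xi=0$ for $1\leqslant i<j\leqslant n$ and $l^-_{ii}\xi=q^{\lambda_i}\xi$ for $1\leqslant i\leqslant n$. Convention: with $y_i=q^{-2\ell_i}$ the formula reads $\sum_k y_k^m\prod_{i\neq k}\frac{q^{-1} y_i-q y_k}{y_i-y_k}$, which simplifies to a symmetric polynomial in $y_1,\dots,y_n$; if some denominators vanish, the formula is understood as the value of this polynomial. *)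

(* Defs.v *)
From HB Require Import structures.
From mathcomp Require Import all_boot all_order all_algebra.
From mathcomp Require Import complex mxtens.
From mathcomp Require Import boolp classical_sets reals sequences exp trigo.
(* Without their notations, which clash with those of MathComp-Analysis. *)
From mathcomp Require Import -(notations) monalg.
From mathcomp Require Import -(notations) mpoly.

Set Implicit Arguments.
Unset Strict Implicit.
Unset Printing Implicit Defensive.

Import Order.TTheory GRing.Theory Num.Theory.
Local Open Scope ring_scope.
Local Open Scope quotient_scope.

Inductive two_sided_ideal (A : nzRingType) (S : A -> Prop) : A -> Prop :=
| ideal_gen x of S x : two_sided_ideal S x
| ideal_0 : two_sided_ideal S 0
| ideal_add x y of two_sided_ideal S x & two_sided_ideal S y :
    two_sided_ideal S (x + y)
| ideal_mull a x of two_sided_ideal S x : two_sided_ideal S (a * x)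
| ideal_mulr a x of two_sided_ideal S x : two_sided_ideal S (x * a).

Definition tens1 n (A : nzRingType) (X : 'M[A]_n) : 'M[A]_(n * n) := X *t 1%:M.
Definition tens2 n (A : nzRingType) (X : 'M[A]_n) : 'M[A]_(n * n) := 1%:M *t X.

Lemma tens_scalar1 n (A : nzRingType) : 1%:M *t 1%:M = 1%:M :> 'M[A]_(n * n).
Proof.
apply/matrixP=> i j; case: (mxtens_indexP i) => i0 i1.
case: (mxtens_indexP j) => j0 j1; rewrite tensmxE !mxE.
by rewrite (can_eq (@mxtens_indexK n n)) xpair_eqE -natrM mulnb.
Qed.

Lemma map_RLL n (A B : nzRingType) (f : {rmorphism A -> B})
    (r : 'M[A]_(n * n)) (X Y : 'M[A]_n) :
  map_mx f X = 1%:M -> map_mx f Y = 1%:M ->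
  map_mx f (r *m tens1 X *m tens2 Y - tens2 Y *m tens1 X *m r) = 0.
Proof.
move=> fX fY; rewrite map_mxB !map_mxM !map_mxT fX fY !map_mx1 tens_scalar1.
by rewrite !mulmx1 mul1mx subrr.
Qed.

Section QuantizedEnvelopingAlgebra.
Variables (K : fieldType) (n : nat) (q : K).

(* End K^n (x) End K^n is 'M_(n * n), and *t is the Kronecker product. *)
Definition Rmatrix : 'M[K]_(n * n) :=
  q *: (\sum_(i < n) delta_mx i i *t delta_mx i i)
  + \sum_(i < n) \sum_(j < n | i != j) delta_mx i i *t delta_mx j j
  + (q - q^-1) *: (\sum_(i < n) \sum_(j < n | (i < j)%N)
                     delta_mx i j *t delta_mx j i).

(* (true, (i, j)) stands for l^+_ij and (false, (i, j)) for l^-_ij. *)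
Definition generator : choiceType := (bool * ('I_n * 'I_n))%type.

(* The free associative algebra: words are multiplied by concatenation. *)
Definition free_alg : Type := malg (fmonom generator) K.

HB.instance Definition _ := GRing.Lalgebra.on free_alg.

Definition free_gen (s : bool) (i j : 'I_n) : free_alg :=
  mkmalgU (fmu ((s, (i, j)) : generator)) 1.

Definition free_L (s : bool) : 'M[free_alg]_n := \matrix_(i, j) free_gen s i j.

Definition free_R : 'M[free_alg]_(n * n) := map_mx (in_alg free_alg) Rmatrix.

(* The differences of the two sides of the defining relations. *)
Inductive Uq_relation : free_alg -> Prop :=
| rel_minus (i j : 'I_n) of (i < j)%N : Uq_relation (free_gen false i j)
| rel_plus (i j : 'I_n) of (i < j)%N : Uq_relation (free_gen true j i)
| rel_diag s i : Uq_relation (free_gen s i i * free_gen (~~ s) i i - 1)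
| rel_RLL s a b : Uq_relation
    ((free_R *m tens1 (free_L s) *m tens2 (free_L s)
      - tens2 (free_L s) *m tens1 (free_L s) *m free_R) a b)
| rel_RLpLm a b : Uq_relation
    ((free_R *m tens1 (free_L true) *m tens2 (free_L false)
      - tens2 (free_L false) *m tens1 (free_L true) *m free_R) a b).

Definition Uq_ideal : {pred free_alg} :=
  fun x => `[< two_sided_ideal Uq_relation x >].

Lemma Uq_ideal_zmod_closed : zmod_closed Uq_ideal.
Proof.
split; first by apply/asboolP; exact: ideal_0.
move=> x y /asboolP hx /asboolP hy; apply/asboolP; apply: ideal_add => //.
by rewrite -mulN1r; apply: ideal_mull.
Qed.

HB.instance Definition _ :=
  GRing.isZmodClosed.Build free_alg Uq_ideal Uq_ideal_zmod_closed.

Definition Uq : Type := Quotient.quot Uq_ideal.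

HB.instance Definition _ := Choice.on Uq.
HB.instance Definition _ := GRing.Zmodule.on Uq.

Definition Uq_pi (x : free_alg) : Uq := \pi_(Quotient.quot Uq_ideal) x.
Definition Uq_repr (u : Uq) : free_alg := repr (u : Quotient.quot Uq_ideal).

Lemma Uq_reprK : cancel Uq_repr Uq_pi.
Proof. by move=> u; rewrite /Uq_pi /Uq_repr reprK. Qed.

Lemma Uq_pi_eq x y :
  Uq_pi x = Uq_pi y <-> two_sided_ideal Uq_relation (x - y).
Proof.
rewrite /Uq_pi; split=> [/eqP|h].
  by rewrite -Quotient.idealrBE => /asboolP.
by apply/eqP; rewrite -Quotient.idealrBE; apply/asboolP.
Qed.

Lemma Uq_piB : zmod_morphism Uq_pi.
Proof. by move=> x y; rewrite /Uq_pi -[RHS]raddfB. Qed.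

HB.instance Definition _ :=
  GRing.isZmodMorphism.Build free_alg Uq Uq_pi Uq_piB.

Definition Uq_one : Uq := Uq_pi 1.
(* Locked, lest unification unfold them in the ring structure on Uq. *)
Definition Uq_mul : Uq -> Uq -> Uq :=
  locked (fun u v => Uq_pi (Uq_repr u * Uq_repr v)).
Definition Uq_scale : K -> Uq -> Uq :=
  locked (fun c u => Uq_pi (c *: Uq_repr u)).

Lemma Uq_repr_pi x : two_sided_ideal Uq_relation (Uq_repr (Uq_pi x) - x).
Proof. by apply/Uq_pi_eq; rewrite Uq_reprK. Qed.

Lemma Uq_piM x y : Uq_pi (x * y) = Uq_mul (Uq_pi x) (Uq_pi y).
Proof.
rewrite /Uq_mul -lock; apply/esym/Uq_pi_eq.
set x' := Uq_repr _; set y' := Uq_repr _.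
have -> : x' * y' - x * y = x' * (y' - y) + (x' - x) * y.
  by rewrite mulrBr mulrBl addrA subrK.
apply: ideal_add; [apply: ideal_mull | apply: ideal_mulr];
  exact: Uq_repr_pi.
Qed.

Lemma Uq_piZ c x : Uq_pi (c *: x) = Uq_scale c (Uq_pi x).
Proof.
rewrite /Uq_scale -lock; apply/esym/Uq_pi_eq; rewrite -scalerBr -[_ - _]mul1r scalerAl.
by apply: ideal_mull; exact: Uq_repr_pi.
Qed.

Lemma Uq_mulA : associative Uq_mul.
Proof.
move=> u v w; rewrite -(Uq_reprK u) -(Uq_reprK v) -(Uq_reprK w).
by rewrite -!Uq_piM mulrA.
Qed.

Lemma Uq_mul1u : left_id Uq_one Uq_mul.
Proof. by move=> u; rewrite -(Uq_reprK u) -Uq_piM mul1r. Qed.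

Lemma Uq_mulu1 : right_id Uq_one Uq_mul.
Proof. by move=> u; rewrite -(Uq_reprK u) -Uq_piM mulr1. Qed.

Lemma Uq_mulDl : left_distributive Uq_mul +%R.
Proof.
move=> u v w; rewrite -(Uq_reprK u) -(Uq_reprK v) -(Uq_reprK w).
by rewrite -raddfD -!Uq_piM -raddfD mulrDl.
Qed.

Lemma Uq_mulDr : right_distributive Uq_mul +%R.
Proof.
move=> u v w; rewrite -(Uq_reprK u) -(Uq_reprK v) -(Uq_reprK w).
by rewrite -raddfD -!Uq_piM -raddfD mulrDr.
Qed.

(* 1 != 0: the relations hold in K with l^+_ij = l^-_ij = (i == j). *)
Definition counit_word (w : fmonom generator) : K :=
  \prod_(g <- (w : seq generator)) (g.2.1 == g.2.2)%:R.

Lemma counit_word_morph : monalg.mmorphism counit_word.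
Proof.
split=> [v w|]; last by rewrite /counit_word fm1 big_nil.
by rewrite /counit_word fmM big_cat.
Qed.

HB.instance Definition _ :=
  monalg.isMultiplicative.Build _ _ counit_word counit_word_morph.

Definition counit : {rmorphism free_alg -> K} :=
  monalg.mmap idfun counit_word.

Lemma counit_gen s i j : counit (free_gen s i j) = (i == j)%:R.
Proof. by rewrite /= monalg.mmapU mul1r /counit_word fmU big_seq1. Qed.

Lemma counit_L s : map_mx counit (free_L s) = 1%:M.
Proof. by apply/matrixP=> i j; rewrite !mxE counit_gen. Qed.

Lemma counit_RLL s t :
  map_mx counit (free_R *m tens1 (free_L s) *m tens2 (free_L t)
      - tens2 (free_L t) *m tens1 (free_L s) *m free_R) = 0.
Proof. by apply: map_RLL; exact: counit_L. Qed.

Lemma counit_ideal x : two_sided_ideal Uq_relation x -> counit x = 0.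
Proof.
elim=> {x}.
- move=> x [i j ij|i j ij|s i|s a b|a b].
  + by rewrite counit_gen -val_eqE /= (ltn_eqF ij).
  + by rewrite counit_gen -val_eqE /= (gtn_eqF ij).
  + by rewrite rmorphB rmorphM rmorph1 !counit_gen eqxx mulr1 subrr.
  + by move/matrixP: (counit_RLL s s) => /(_ a b); rewrite [LHS]mxE [RHS]mxE.
  + by move/matrixP: (counit_RLL true false) => /(_ a b); rewrite [LHS]mxE [RHS]mxE.
- by rewrite rmorph0.
- by move=> x y _ hx _ hy; rewrite rmorphD hx hy addr0.
- by move=> a x _ hx; rewrite rmorphM hx mulr0.
- by move=> a x _ hx; rewrite rmorphM hx mul0r.
Qed.

Lemma Uq_one_neq0 : Uq_one != 0.
Proof.
apply/eqP; rewrite -(raddf0 Uq_pi) => /Uq_pi_eq; rewrite subr0.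
by move=> /counit_ideal /eqP; rewrite rmorph1 oner_eq0.
Qed.

HB.instance Definition _ := GRing.Zmodule_isNzRing.Build Uq
  Uq_mulA Uq_mul1u Uq_mulu1 Uq_mulDl Uq_mulDr Uq_one_neq0.

Lemma Uq_pi_monoid_morphism : monoid_morphism Uq_pi.
Proof. by split; [exact: erefl | exact: Uq_piM]. Qed.

HB.instance Definition _ :=
  GRing.isMonoidMorphism.Build free_alg Uq Uq_pi Uq_pi_monoid_morphism.

Lemma Uq_scaleA a b u : Uq_scale a (Uq_scale b u) = Uq_scale (a * b) u.
Proof. by rewrite -(Uq_reprK u) -!Uq_piZ scalerA. Qed.

Lemma Uq_scale1 : left_id 1 Uq_scale.
Proof. by move=> u; rewrite -(Uq_reprK u) -Uq_piZ scale1r. Qed.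

Lemma Uq_scaleDr : right_distributive Uq_scale +%R.
Proof.
move=> a u v; rewrite -(Uq_reprK u) -(Uq_reprK v) -raddfD -!Uq_piZ -raddfD.
by rewrite scalerDr.
Qed.

Lemma Uq_scaleDl u : {morph Uq_scale^~ u : a b / a + b}.
Proof. by move=> a b; rewrite -(Uq_reprK u) -!Uq_piZ -raddfD scalerDl. Qed.

HB.instance Definition _ := GRing.Zmodule_isLmodule.Build K Uq
  Uq_scaleA Uq_scale1 Uq_scaleDr Uq_scaleDl.

Lemma Uq_scaleAl a (u v : Uq) : a *: (u * v) = (a *: u) * v.
Proof.
change (Uq_scale a (u * v) = Uq_scale a u * v).
by rewrite -(Uq_reprK u) -(Uq_reprK v) -rmorphM -!Uq_piZ -rmorphM scalerAl.
Qed.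

HB.instance Definition _ := GRing.Lmodule_isLalgebra.Build K Uq Uq_scaleAl.

Lemma free_scaleAr a (x y : free_alg) : a *: (x * y) = x * (a *: y).
Proof.
have central (z : free_alg) : z * (mkmalgU mone a : free_alg) = a *: z.
  rewrite -mul_malgC [LHS]fgmulgU [RHS]fgmulUg; apply: eq_bigr => k _.
  by rewrite mulrC mulm1 mul1m.
have -> : a *: y = y * (mkmalgU mone a : free_alg) by rewrite central.
by rewrite mulrA central.
Qed.

Lemma Uq_scaleAr a (u v : Uq) : a *: (u * v) = u * (a *: v).
Proof.
change (Uq_scale a (u * v) = u * Uq_scale a v).
by rewrite -(Uq_reprK u) -(Uq_reprK v) -rmorphM -!Uq_piZ -rmorphM free_scaleAr.
Qed.

HB.instance Definition _ := GRing.Lalgebra_isAlgebra.Build K Uq Uq_scaleAr.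

Definition Lplus : 'M[Uq]_n := map_mx Uq_pi (free_L true).
Definition Lminus : 'M[Uq]_n := map_mx Uq_pi (free_L false).

Definition Dmatrix : 'M[K]_n :=
  diag_mx (\row_(i < n) q ^ (n%:Z - 1 - (2 * i)%:Z)).

End QuantizedEnvelopingAlgebra.

(* invmx only covers commutative coefficient rings; a two-sided inverse is
   unique when it exists. *)
Definition mxinv n (A : nzRingType) (X : 'M[A]_n) : 'M[A]_n :=
  xget 0 [set Y : 'M[A]_n | X *m Y = 1%:M /\ Y *m X = 1%:M]%classic.

Lemma mxinvP n (A : nzRingType) (X Y : 'M[A]_n) :
  X *m Y = 1%:M -> Y *m X = 1%:M ->
  X *m mxinv X = 1%:M /\ mxinv X *m X = 1%:M.
Proof.
move=> XY YX; rewrite /mxinv.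
by case: xgetP => [Z _ []//|/(_ Y)]; case; split.
Qed.

Lemma upper_mx_inv (A : nzRingType) n (X : 'M[A]_n) :
  (forall i j : 'I_n, (j < i)%N -> X i j = 0) ->
  (forall i, exists b, X i i * b = 1 /\ b * X i i = 1) ->
  exists Y, X *m Y = 1%:M /\ Y *m X = 1%:M.
Proof.
elim: n X => [|n IH] X X0 Xd.
  by exists 0; split; apply/matrixP=> -[].
have [b [Xb bX]] := Xd 0.
pose X' : 'M[A]_(1 + n) := X.
have dl0 : dlsubmx X' = 0.
  by apply/matrixP=> i j; rewrite !mxE; apply: X0; rewrite !ord1.
have [Z [XZ ZX]] : exists Z, drsubmx X' *m Z = 1%:M /\ Z *m drsubmx X' = 1%:M.
  apply: IH => [i j ij|i]; first by rewrite !mxE; apply: X0.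
  by have [c] := Xd (rshift 1 i); exists c; rewrite !mxE.
have ulE : ulsubmx X' = (X 0 0)%:M.
  by rewrite [LHS]mx11_scalar !mxE; congr (X _ _)%:M; apply: val_inj.
have XbM : (X 0 0)%:M *m b%:M = 1%:M :> 'M_1 by rewrite -scalar_mxM Xb.
have bXM : b%:M *m (X 0 0)%:M = 1%:M :> 'M_1 by rewrite -scalar_mxM bX.
pose W : 'M[A]_(1 + n) :=
  block_mx (X 0 0)%:M (ursubmx X') 0 (drsubmx X').
pose Y : 'M[A]_(1 + n) := block_mx b%:M (- (b%:M *m ursubmx X' *m Z)) 0 Z.
have XE : X' = W by rewrite -[LHS]submxK dl0 ulE.
have WY : W *m Y = 1%:M.
  rewrite mulmx_block XZ XbM !mulmx0 !mul0mx addr0 !add0r.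
  by rewrite mulmxN !mulmxA XbM mul1mx addNr -scalar_mx_block.
have YW : Y *m W = 1%:M.
  rewrite mulmx_block ZX bXM !mulmx0 !mul0mx addr0 !add0r.
  by rewrite mulNmx -!mulmxA ZX mulmx1 subrr -scalar_mx_block.
by exists Y; rewrite -XE in WY YW.
Qed.

Lemma lower_mx_inv (A : nzRingType) n (X : 'M[A]_n) :
  (forall i j : 'I_n, (i < j)%N -> X i j = 0) ->
  (forall i, exists b, X i i * b = 1 /\ b * X i i = 1) ->
  exists Y, X *m Y = 1%:M /\ Y *m X = 1%:M.
Proof.
move=> X0 Xd; have revM (U V : 'M[A]_n) :
    mxsub (@rev_ord n) (@rev_ord n) U *m mxsub (@rev_ord n) (@rev_ord n) V
    = mxsub (@rev_ord n) (@rev_ord n) (U *m V).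
  apply/matrixP=> i j; rewrite !mxE (reindex_inj rev_ord_inj) /=.
  by apply: eq_bigr => k _; rewrite !mxE rev_ordK.
have rev1 : mxsub (@rev_ord n) (@rev_ord n) 1%:M = 1%:M :> 'M[A]_n.
  by apply/matrixP=> i j; rewrite !mxE (inj_eq rev_ord_inj).
have revK (U : 'M[A]_n) :
    mxsub (@rev_ord n) (@rev_ord n) (mxsub (@rev_ord n) (@rev_ord n) U) = U.
  by apply/matrixP=> i j; rewrite !mxE !rev_ordK.
have [|i|Y [XY YX]] := @upper_mx_inv A n (mxsub (@rev_ord n) (@rev_ord n) X).
- move=> i j ij; rewrite mxE; apply: X0 => /=.
  by rewrite ltn_sub2l // (leq_ltn_trans _ (ltn_ord i)).
- by rewrite mxE.
exists (mxsub (@rev_ord n) (@rev_ord n) Y).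
by split; rewrite -{1}(revK X) revM ?XY ?YX rev1.
Qed.

Lemma Uq_rel0 (K : fieldType) n (q : K) x :
  Uq_relation q x -> Uq_pi q x = 0 :> Uq n q.
Proof.
by move=> h; rewrite -(raddf0 (@Uq_pi K n q)); apply/Uq_pi_eq; rewrite subr0;
  apply: ideal_gen.
Qed.

Lemma Uq_diag (K : fieldType) n (q : K) s (i : 'I_n) :
  Uq_pi q (free_gen K s i i) * Uq_pi q (free_gen K (~~ s) i i) = 1.
Proof.
apply/eqP; rewrite -subr_eq0 -(rmorph1 (@Uq_pi K n q)) -rmorphM -rmorphB.
by apply/eqP/Uq_rel0/rel_diag.
Qed.

Lemma Lplus_inv (K : fieldType) n (q : K) :
  Lplus n q *m mxinv (Lplus n q) = 1%:M
  /\ mxinv (Lplus n q) *m Lplus n q = 1%:M.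
Proof.
have [i j ij|i|Y [XY YX]] := @upper_mx_inv _ _ (Lplus n q).
- by rewrite mxE [free_L _ _ _ _ _]mxE; apply/Uq_rel0/rel_plus.
- exists (Lminus n q i i); rewrite !mxE; split; first exact: (Uq_diag q true).
  exact: (Uq_diag q false).
exact: mxinvP XY YX.
Qed.

Lemma Lminus_inv (K : fieldType) n (q : K) :
  Lminus n q *m mxinv (Lminus n q) = 1%:M
  /\ mxinv (Lminus n q) *m Lminus n q = 1%:M.
Proof.
have [i j ij|i|Y [XY YX]] := @lower_mx_inv _ _ (Lminus n q).
- by rewrite mxE [free_L _ _ _ _ _]mxE; apply/Uq_rel0/rel_minus.
- exists (Lplus n q i i); rewrite !mxE; split; first exact: (Uq_diag q false).
  exact: (Uq_diag q true).
exact: mxinvP XY YX.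
Qed.

(* A representation of Uq is a left Uq-module V; the complex scalar c acts on
   V as c%:A. *)
Section HighestWeight.
Variables (R : realType) (n : nat) (q logq : R[i]).

Definition cexp (z : R[i]) : R[i] :=
  real_complex R (expR (complex.Re z))
  * Complex (cos (complex.Im z)) (sin (complex.Im z)).

(* q^a = e^(a log q), where logq is the chosen logarithm: cexp logq = q. *)
Definition qpow (a : R) : R[i] := cexp (real_complex R a * logq).

Definition qnum (a : R) : R[i] := (qpow a - qpow (- a)) / (q - q^-1).

Record is_Lq (lam : 'I_n -> R) (V : lmodType (Uq n q)) (xi : V) : Prop := {
  Lq_neq0 : xi != 0;
  Lq_plus : forall i j : 'I_n, (i < j)%N -> Lplus n q i j *: xi = 0;
  Lq_weight : forall i : 'I_n,
    Lminus n q i i *: xi = ((qpow (lam i))%:A : Uq n q) *: xi;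
  Lq_generated : forall v : V, exists u : Uq n q, v = u *: xi;
  Lq_irreducible : forall W : {pred V},
    submod_closed W -> W =i pred1 0 \/ W =i predT
}.

(* 'I_n starts at 0, whence the shift. *)
Definition ell (lam : 'I_n -> R) (i : 'I_n) : R := lam i + (n - i.+1)%:R.

(* The symmetric polynomial to which
   sum_k y_k^m prod_(i != k) (q^-1 y_i - q y_k) / (y_i - y_k) simplifies;
   it is determined by its values at the points with distinct coordinates. *)
Definition is_gelfand_poly (m : nat) (P : mpoly n R[i]) : Prop :=
  P \is @symmetric n R[i] /\
  forall y : 'I_n -> R[i], injective y ->
    meval y P =
      \sum_(k < n) y k ^+ m *
        \prod_(i < n | i != k) ((q^-1 * y i - q * y k) / (y i - y k)).

Definition gelfand_formula (m : nat) (l : 'I_n -> R) : R[i] :=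
  \sum_(k < n) qpow (- 2 * l k * m%:R) *
    \prod_(i < n | i != k) (qnum (l i - l k + 1) / qnum (l i - l k)).

(* P is meant to satisfy is_gelfand_poly; y_i = q^(-2 l_i). *)
Definition gelfand_eigenvalue (m : nat) (P : mpoly n R[i])
    (l : 'I_n -> R) : R[i] :=
  if [forall k : 'I_n, forall i : 'I_n, (i != k) ==> (qnum (l i - l k) != 0)]
  then gelfand_formula m l
  else meval (fun i => qpow (- 2 * l i)) P.

End HighestWeight.

(* Main.v *)
Require Import Defs.
From HB Require Import structures.
From mathcomp Require Import all_boot all_order all_algebra.
From mathcomp Require Import fingroup perm.
From mathcomp Require Import complex mxtens ring.
From mathcomp Require Import boolp classical_sets reals sequences exp trigo.
From mathcomp Require Import -(notations) monalg.
From mathcomp Require Import -(notations) mpoly.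

Set Implicit Arguments.
Unset Strict Implicit.
Unset Printing Implicit Defensive.

Import Order.TTheory GRing.Theory Num.Theory.
Local Open Scope ring_scope.

(** Put [M = (L^-)^-1 L^+] and [N = L^+ (L^-)^-1], and let [S] be the inverse
    of [R21], the flip of [R].

    Everything comes from two commutations in [End (x) End (x) U]: the matrix
    [M_2] commutes with [L^+_1 R] and with [L^-_1 S] ([comm_M_Lplus],
    [comm_M_Lminus]).  Hence so does [X_2], for [X] any power of [M] or of
    its inverse [(L^+)^-1 L^-].  Both [R] and [S] have the shape [braid a b o],
    with [o] one of the two orders on indices, and the diagonal entries of
    [D] and [D^-1] solve the triangular systems that arise when a partial
    trace meets such a matrix ([qdimV_above] and its three companions).  So
    each partial trace of the relation between [X_2] and [L_1] is a usable
    formula: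

    - tracing the second factor against [D^-1] shows that [tr D^-1 X] commutes
      with the entries of [L] ([exchange_central]), and these generate the
      algebra ([Uq_gen_central]);
    - contracting the two inner indices expresses [L X] through products in
      which the entries of [X] come first; together with the dual form
      [sum_i D_i L_ij (L^-1)_ki = D_j delta_jk] of the inverse
      ([dual_inverse]) this gives [tr D L X L^-1 = tr D^-1 X]
      ([exchange_trace]).  As [N^m = L^- M^m (L^-)^-1], the two families of
      traces agree;
    - contracting the two outer indices of the inverted relation expresses
      [X (L^-)^-1] through products in which the entries of [X] come last
      ([mulmx_Lminus_inv]).  Applied to the highest weight vector it shows by
      induction on [m] that [M^m] is lower triangular there, and yields a
      linear recursion for the eigenvalues of its diagonal entries
      ([eigen_M_exp]).

    With [y_k = q^(-2 l_k)], that recursion says that the eigenvalue of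
    [tr D^-1 M^m] is the value at [y] of a function of lists which is built
    by adding the variables one at a time ([gelfand_sum], [gelfand_sum_rec]).
    It has polynomial coefficients and does not depend on the order of the
    variables ([gelfand_sum_perm]), so it is a symmetric polynomial; and the
    rational expression of the statement obeys the same recursion
    ([gelfand_sum_formula]).  Being central, the trace acts by this
    eigenvalue on the whole module, which the highest weight vector
    generates. *)

(** * Matrices over the tensor square *)

Local Notation "<| i , k |>" := (mxtens_index (i, k)) (at level 0).

Lemma sum_mxtens (V : nmodType) n (F : 'I_(n * n) -> V) :
  \sum_x F x = \sum_i \sum_k F <|i, k|>.
Proof.
rewrite pair_bigA (reindex (fun p => <|p.1, p.2|>)) //=.
exists (@mxtens_unindex n n) => [[i k]|x] _; first by rewrite mxtens_indexK.
by rewrite -surjective_pairing mxtens_unindexK.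
Qed.

Lemma sum_mulrb_eq (V : nmodType) (I : finType) (k : I) (F : I -> V) :
  \sum_b F b *+ (k == b) = F k.
Proof.
rewrite (bigD1 k) //= eqxx big1 ?addr0 // => b /negPf bk.
by rewrite eq_sym bk.
Qed.

Section Tens.
Variables (A : nzRingType) (n : nat).
Implicit Types X : 'M[A]_n.

Lemma tens1E X i j k l : tens1 X <|i, k|> <|j, l|> = X i j *+ (k == l).
Proof. by rewrite tensmxE mxE mulr_natr. Qed.

Lemma tens2E X i j k l : tens2 X <|i, k|> <|j, l|> = X k l *+ (i == j).
Proof. by rewrite tensmxE mxE mulr_natl. Qed.

Lemma mul_tens1E X (Y : 'M[A]_(n * n)) i k y :
  (tens1 X *m Y) <|i, k|> y = \sum_a X i a * Y <|a, k|> y.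
Proof.
rewrite mxE sum_mxtens; apply: eq_bigr => a _.
rewrite -(sum_mulrb_eq k (fun b => X i a * Y <|a, b|> y)).
by apply: eq_bigr => b _; rewrite tens1E mulrnAl.
Qed.

Lemma mul_tens2E X (Y : 'M[A]_(n * n)) i k y :
  (tens2 X *m Y) <|i, k|> y = \sum_b X k b * Y <|i, b|> y.
Proof.
rewrite mxE sum_mxtens exchange_big; apply: eq_bigr => b _ /=.
rewrite -(sum_mulrb_eq i (fun a => X k b * Y <|a, b|> y)).
by apply: eq_bigr => a _; rewrite tens2E mulrnAl.
Qed.

Lemma tens2_tens1E X Y i j k l :
  (tens2 X *m tens1 Y) <|i, k|> <|j, l|> = X k l * Y i j.
Proof.
rewrite mul_tens2E -(sum_mulrb_eq l (fun b => X k b * Y i j)).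
by apply: eq_bigr => b _; rewrite tens1E mulrnAr eq_sym.
Qed.

Lemma tens1_tens2E X Y i j k l :
  (tens1 X *m tens2 Y) <|i, k|> <|j, l|> = X i j * Y k l.
Proof.
rewrite mul_tens1E -(sum_mulrb_eq j (fun a => X i a * Y k l)).
by apply: eq_bigr => a _; rewrite tens2E mulrnAr eq_sym.
Qed.

Lemma tens1M X Y : tens1 (X *m Y) = tens1 X *m tens1 Y.
Proof.
apply/matrixP=> x y; case: (mxtens_indexP x) => i k.
case: (mxtens_indexP y) => j l; rewrite tens1E mul_tens1E mxE -sumrMnl.
by apply: eq_bigr => a _; rewrite tens1E mulrnAr.
Qed.

Lemma tens2M X Y : tens2 (X *m Y) = tens2 X *m tens2 Y.
Proof.
apply/matrixP=> x y; case: (mxtens_indexP x) => i k.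
case: (mxtens_indexP y) => j l; rewrite tens2E mul_tens2E mxE -sumrMnl.
by apply: eq_bigr => a _; rewrite tens2E mulrnAr.
Qed.

Lemma tens1_1 : tens1 1%:M = 1%:M :> 'M[A]_(n * n).
Proof. exact: tens_scalar1. Qed.

Lemma tens2_1 : tens2 1%:M = 1%:M :> 'M[A]_(n * n).
Proof. exact: tens_scalar1. Qed.

(** Conjugation by the flip of the two tensor factors. *)
Definition flip_mx (Y : 'M[A]_(n * n)) : 'M[A]_(n * n) :=
  let f (x : 'I_(n * n)) := <|(mxtens_unindex x).2, (mxtens_unindex x).1|> in
  mxsub f f Y.

Lemma flip_mxE Y i j k l : flip_mx Y <|i, k|> <|j, l|> = Y <|k, i|> <|l, j|>.
Proof. by rewrite mxE !mxtens_indexK. Qed.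

Lemma flip_mxM Y Z : flip_mx (Y *m Z) = flip_mx Y *m flip_mx Z.
Proof.
apply/matrixP=> x y; case: (mxtens_indexP x) => i k.
case: (mxtens_indexP y) => j l; rewrite flip_mxE !mxE !sum_mxtens exchange_big.
by apply: eq_bigr => a _; apply: eq_bigr => b _; rewrite !flip_mxE.
Qed.

Lemma flip_tens1 X : flip_mx (tens1 X) = tens2 X.
Proof.
apply/matrixP=> x y; case: (mxtens_indexP x) => i k.
by case: (mxtens_indexP y) => j l; rewrite flip_mxE tens1E tens2E.
Qed.

Lemma flip_tens2 X : flip_mx (tens2 X) = tens1 X.
Proof.
apply/matrixP=> x y; case: (mxtens_indexP x) => i k.
by case: (mxtens_indexP y) => j l; rewrite flip_mxE tens1E tens2E.
Qed.

End Tens.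

Section Braid.
Variables (K : fieldType) (A : algType K) (n : nat).
Implicit Types (X Y L : 'M[A]_n) (a b : K) (o : rel 'I_n).

(** On basis vectors, from the left: [e_i (x) e_k] goes to
    [a ^ (i == k) e_i (x) e_k + b (o i k) e_k (x) e_i].  With [o] one of the
    two strict orders on indices this covers [R], its flip, and their
    inverses. *)
Definition braid a b o : 'M[A]_(n * n) :=
  \matrix_(x, y) let: (i, k) := mxtens_unindex x in
                 let: (j, l) := mxtens_unindex y in
    (a ^+ (i == k) *+ ((i == j) && (k == l))
     + b *+ [&& o i k, i == l & k == j])%:A.

Lemma braidE a b o i j k l : braid a b o <|i, k|> <|j, l|> =
  (a ^+ (i == k) *+ ((i == j) && (k == l))
   + b *+ [&& o i k, i == l & k == j])%:A.
Proof. by rewrite mxE !mxtens_indexK. Qed.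

Lemma mul_braidE a b o (Y : 'M[A]_(n * n)) i k y :
  (braid a b o *m Y) <|i, k|> y =
  a ^+ (i == k) *: Y <|i, k|> y + (b *+ o i k) *: Y <|k, i|> y.
Proof.
rewrite mxE sum_mxtens.
under eq_bigr do under eq_bigr do rewrite braidE -scalerAl mul1r scalerDl.
under eq_bigr do rewrite big_split.
rewrite big_split /=; congr (_ + _).
  rewrite -(sum_mulrb_eq i (fun j => a ^+ (i == k) *: Y <|j, k|> y)).
  apply: eq_bigr => j _; case: (eqVneq i j) => [<-|_] /=; last first.
    by rewrite big1 // => l _; rewrite mulr0n scale0r.
  rewrite -[RHS](sum_mulrb_eq k (fun l => a ^+ (i == k) *: Y <|i, l|> y)).
  by apply: eq_bigr => l _; case: (eqVneq k l) => _; rewrite ?mulr0n ?scale0r.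
rewrite -(sum_mulrb_eq k (fun j => (b *+ o i k) *: Y <|j, i|> y)).
apply: eq_bigr => j _; case: (eqVneq k j) => [<-|_] /=; last first.
  by rewrite big1 // => l _; rewrite !andbF mulr0n scale0r.
rewrite -[RHS](sum_mulrb_eq i (fun l => (b *+ o i k) *: Y <|k, l|> y)).
apply: eq_bigr => l _; rewrite andbT.
by case: (eqVneq i l); rewrite ?andbT ?andbF ?mulr0n ?scale0r.
Qed.

Lemma mulmx_braidE a b o (Y : 'M[A]_(n * n)) x j l :
  (Y *m braid a b o) x <|j, l|> =
  a ^+ (j == l) *: Y x <|j, l|> + (b *+ o l j) *: Y x <|l, j|>.
Proof.
rewrite mxE sum_mxtens.
under eq_bigr do under eq_bigr do rewrite braidE -scalerAr mulr1 scalerDl.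
under eq_bigr do rewrite big_split.
rewrite big_split /=; congr (_ + _).
  rewrite -(sum_mulrb_eq j (fun i => a ^+ (j == l) *: Y x <|i, l|>)).
  apply: eq_bigr => i _; rewrite [j == i]eq_sym; case: (eqVneq i j) => [->|_] /=.
    rewrite -[RHS](sum_mulrb_eq l (fun k => a ^+ (j == l) *: Y x <|j, k|>)).
    apply: eq_bigr => k _; rewrite [l == k]eq_sym.
    by case: (eqVneq k l) => [->|_]; rewrite ?mulr0n ?scale0r.
  by rewrite big1 // => k _; rewrite mulr0n scale0r.
rewrite -(sum_mulrb_eq l (fun i => (b *+ o l j) *: Y x <|i, j|>)).
apply: eq_bigr => i _; rewrite [l == i]eq_sym; case: (eqVneq i l) => [->|_] /=; last first.
  by rewrite big1 // => k _; rewrite !andbF mulr0n scale0r.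
rewrite -[RHS](sum_mulrb_eq j (fun k => (b *+ o l j) *: Y x <|l, k|>)).
apply: eq_bigr => k _; rewrite [j == k]eq_sym.
by case: (eqVneq k j) => [->|_]; rewrite ?andbT ?andbF ?mulr0n ?scale0r.
Qed.

(** On the span of [e_i (x) e_k] and [e_k (x) e_i] the matrix is diagonal for
    [i = k] and unipotent triangular otherwise. *)
Lemma braid_mulV a b o : a != 0 -> antisymmetric o -> irreflexive o ->
  braid a b o *m braid a^-1 (- b) o = 1%:M.
Proof.
move=> a0 oas oirr; apply/matrixP=> x y; case: (mxtens_indexP x) => i k.
case: (mxtens_indexP y) => j l; rewrite mul_braidE !braidE !mxE.
rewrite (can_eq (@mxtens_indexK n n)) xpair_eqE !scalerA -scalerDl.
rewrite -[RHS](scaler_nat _ (1 : A)); congr (_ *: _).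
have [<-|ik] := eqVneq i k.
  rewrite oirr mulr0n mul0r !addr0 !expr1 mulrnAr divff //.
rewrite /= !expr0 !mul1r.
case oik: (o i k) => /=; last by rewrite mulr0n addr0 mul0r addr0.
have -> : o k i = false.
  by apply/negP=> oki; case/eqP: ik; apply: oas; rewrite oik oki.
rewrite mulr0n addr0 mulr1n [(k == j) && _]andbC mulrnAr mulr1.
by rewrite mulNrn subrK.
Qed.

Lemma flip_braid a b o :
  flip_mx (braid a b o) = braid a b (fun i k => o k i).
Proof.
apply/matrixP=> x y; case: (mxtens_indexP x) => i k.
case: (mxtens_indexP y) => j l; rewrite flip_mxE !braidE.
by rewrite [k == i]eq_sym [(k == l) && _]andbC [(k == j) && _]andbC.
Qed.

End Braid.

(** * Contractions of an exchange relation *)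

Section Exchange.
Variables (K : fieldType) (A : algType K) (n : nat).
Variables (a b : K) (o : rel 'I_n).
Implicit Types (X Y L : 'M[A]_n) (c d : 'I_n -> K).
Let B : 'M[A]_(n * n) := braid A a b o.

Lemma tens1_braid_tens2E L X i j k l :
  (tens1 L *m B *m tens2 X) <|i, k|> <|j, l|> =
  a ^+ (j == k) *: (L i j * X k l)
  + (\sum_(x | o x k) b *: (L i x * X x l)) *+ (k == j).
Proof.
rewrite -mulmxA mul_tens1E.
under eq_bigr do rewrite mul_braidE !tens2E mulrDr -!scalerAr !mulrnAr.
rewrite big_split /=; congr (_ + _).
  rewrite -(sum_mulrb_eq j (fun x => a ^+ (j == k) *: (L i x * X k l))).
  apply: eq_bigr => x _; rewrite [x == j]eq_sym.
  by case: (eqVneq j x) => [->|_]; rewrite ?mulr1n // !mulr0n scaler0.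
rewrite [in RHS]big_mkcond -sumrMnl; apply: eq_bigr => x _.
by case: (o x k); rewrite ?mulr1n ?mulr0n ?scalerMnr ?scale0r ?mul0rn.
Qed.

Lemma tens2_braid_tens1E X Y i j k l :
  (tens2 X *m B *m tens1 Y) <|i, k|> <|j, l|> =
  a ^+ (i == l) *: (X k l * Y i j)
  + (\sum_(x | o i x) b *: (X k x * Y x j)) *+ (i == l).
Proof.
rewrite -mulmxA mul_tens2E.
under eq_bigr do rewrite mul_braidE !tens1E mulrDr -!scalerAr !mulrnAr.
rewrite big_split /=; congr (_ + _).
  rewrite -(sum_mulrb_eq l (fun x => a ^+ (i == l) *: (X k x * Y i j))).
  apply: eq_bigr => x _; rewrite [x == l]eq_sym.
  by case: (eqVneq l x) => [->|_]; rewrite ?mulr1n // !mulr0n scaler0.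
rewrite [in RHS]big_mkcond -sumrMnl; apply: eq_bigr => x _.
by case: (o i x); rewrite ?mulr1n ?mulr0n ?scalerMnr ?scale0r ?mul0rn.
Qed.

(** Contracting the two inner indices turns the product with [braid] into a
    combination of the products [L i x * X x l].  If the coefficients
    [a * c x + b * ...] are all equal, it is a multiple of the matrix
    product. *)
Lemma contract_tens1_tens2 c L X i l :
  \sum_j c j *: (tens1 L *m B *m tens2 X) <|i, j|> <|j, l|> =
  \sum_x (a * c x + b * \sum_(j | o x j) c j) *: (L i x * X x l).
Proof.
under eq_bigr do rewrite tens1_braid_tens2E eqxx expr1 mulr1n scalerDr scalerA.
under [RHS]eq_bigr do rewrite scalerDl.
rewrite !big_split /=; congr (_ + _).
  by apply: eq_bigr => x _; rewrite mulrC.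
under eq_bigr do rewrite scaler_sumr.
rewrite (exchange_big_dep predT) //=; apply: eq_bigr => x _.
rewrite mulr_sumr scaler_suml; apply: eq_bigr => j _.
by rewrite scalerA mulrC.
Qed.

(** The same for the two outer indices. *)
Lemma contract_tens2_tens1 d X Y k j :
  \sum_i d i *: (tens2 X *m B *m tens1 Y) <|i, k|> <|j, i|> =
  \sum_x (a * d x + b * \sum_(i | o i x) d i) *: (X k x * Y x j).
Proof.
under eq_bigr do rewrite tens2_braid_tens1E eqxx expr1 mulr1n scalerDr scalerA.
under [RHS]eq_bigr do rewrite scalerDl.
rewrite !big_split /=; congr (_ + _).
  by apply: eq_bigr => x _; rewrite mulrC.
under eq_bigr do rewrite scaler_sumr.
rewrite (exchange_big_dep predT) //=; apply: eq_bigr => x _.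
rewrite mulr_sumr scaler_suml; apply: eq_bigr => i _.
by rewrite scalerA mulrC.
Qed.

Section Commuting.
Variables L X : 'M[A]_n.
Hypothesis LX : tens2 X *m (tens1 L *m B) = tens1 L *m B *m tens2 X.

(** The relation between [X] and [L] entry by entry: reading off [R] leaves at
    most two terms on the left and, for [k = j], one extra sum on the
    right. *)
Lemma exchange_entries i j k l :
  a ^+ (j == l) *: (X k l * L i j) + (b *+ o l j) *: (X k j * L i l) =
  a ^+ (j == k) *: (L i j * X k l)
  + (\sum_(x | o x k) b *: (L i x * X x l)) *+ (k == j).
Proof.
rewrite -tens1_braid_tens2E -LX mulmxA mulmx_braidE.
by rewrite !tens2_tens1E.
Qed.

(** Taking [l = k] in the entries of the relation and summing with weights
    [c k] gives the commutator in question as a combination of products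
    [X k j * L i k] with [o k j].  The relation itself moves [X] to the right
    in these; what remains is a combination of the [L i x * X x j], whose
    coefficients vanish by the condition on [c]. *)
Lemma exchange_central c i j : a != 0 -> irreflexive o ->
  antisymmetric o -> transitive o ->
  (forall x y, o x y ->
    c y * a^-1 = c x * a + b * \sum_(k | o x k && o k y) c k) ->
  (\sum_k c k *: X k k) * L i j = L i j * (\sum_k c k *: X k k).
Proof.
move=> a0 oirr oas otr hc.
have onsym x y : o x y -> o y x = false.
  move=> xy; apply/negP=> yx; have exy : x = y by apply: oas; rewrite xy yx.
  by rewrite exy oirr in xy.
apply/eqP; rewrite -subr_eq0 mulr_suml mulr_sumr -sumrB; apply/eqP.
pose T x := L i x * X x j.
have diag k : X k k * L i j - L i j * X k k =
    (\sum_(x | o x j) (a^-1 * b) *: T x) *+ (k == j)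
    - (b *+ o k j) *: (X k j * L i k).
  have := exchange_entries i j k k; rewrite [j == k]eq_sym.
  case: (eqVneq k j) => [->|kj] e.
    rewrite oirr mulr0n !scale0r !addr0 ?subr0 !mulr1n expr1 in e *.
    apply: (scalerI a0); rewrite scalerBr e addrC addKr scaler_sumr.
    by apply: eq_bigr => x _; rewrite scalerA mulrA divff ?mul1r.
  rewrite !mulr0n !addr0 !expr0 !scale1r in e *.
  by rewrite -e opprD addrA subrr !sub0r.
have off k : o k j ->
    X k j * L i k = a *: T k + \sum_(x | o x k) b *: T x.
  move=> kj; have := exchange_entries i k k j.
  have -> : (k == j) = false by apply/eqP=> e; rewrite e oirr in kj.
  by rewrite (onsym _ _ kj) eqxx mulr0n scale0r addr0 expr0 scale1r expr1.
transitivity (\sum_(x | o x j) (b * (c j * a^-1 - c x * a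
    - b * \sum_(k | o x k && o k j) c k)) *: T x); last first.
  by rewrite big1 // => x xj; rewrite (hc _ _ xj) -addrA -opprD subrr mulr0 scale0r.
under eq_bigr => k _ do rewrite -scalerAl -scalerAr -scalerBr diag scalerBr.
rewrite sumrB (bigD1 j) //= eqxx mulr1n [X in _ + X - _]big1 => [|k /negPf ->]; last first.
  by rewrite mulr0n scaler0.
rewrite addr0 scaler_sumr.
have -> : \sum_k c k *: ((b *+ o k j) *: (X k j * L i k)) =
    \sum_(x | o x j) (c x * (b * a)) *: T x
    + \sum_(x | o x j) (b * (b * \sum_(k | o x k && o k j) c k)) *: T x.
  transitivity (\sum_(k | o k j) c k *: (b *: (X k j * L i k))).
    rewrite [RHS]big_mkcond; apply: eq_bigr => k _.
    by case: (o k j); rewrite ?mulr1n // mulr0n scale0r scaler0.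
  under eq_bigr => k kj do rewrite off // !scalerDr !scalerA.
  rewrite big_split /=; congr (_ + _).
    by apply: eq_bigr => x _; congr (_ *: _); ring.
  under eq_bigr do rewrite scaler_sumr.
  rewrite (exchange_big_dep (fun x => o x j)) /=; last first.
    by move=> k x kj xk; apply: otr xk kj.
  apply: eq_bigr => x xj; rewrite !mulr_sumr scaler_suml.
  apply: eq_big => [k|k _]; first by rewrite andbC.
  by rewrite scalerA; congr (_ *: _); ring.
rewrite -big_split -sumrB; apply: eq_bigr => x _ /=.
by rewrite scalerA -scalerDl -scalerBl; congr (_ *: _); ring.
Qed.

(** The hypothesis on [c] makes [kappa (L X)] an inner contraction, which the
    relation rewrites with the entries of [X] on the left.  Only entries of
    [L] and [L'] then stand to the right of [X], in the combination that the
    last hypothesis evaluates, and the hypothesis on [d] sums up the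
    outcome. *)
Lemma exchange_trace c d kappa L' : kappa != 0 ->
  (forall x, a * c x + b * \sum_(j | o x j) c j = kappa) ->
  (forall x, a * d x + b * \sum_(i | o i x) d i = kappa) ->
  (forall j k, \sum_i d i *: (L i j * L' k i) = (d j *+ (j == k))%:A) ->
  \sum_i d i *: (L *m X *m L') i i = \sum_k c k *: X k k.
Proof.
move=> kappa0 hc hd hL'; apply: (scalerI kappa0).
have LXE i l : kappa *: (L *m X) i l = \sum_j c j *:
    (a ^+ (j == l) *: (X j l * L i j) + (b *+ o l j) *: (X j j * L i l)).
  have := contract_tens1_tens2 c L X i l.
  under [X in _ = X -> _]eq_bigr do rewrite hc.
  rewrite -scaler_sumr mxE => <-; rewrite -LX mulmxA.
  by apply: eq_bigr => j _; rewrite mulmx_braidE !tens2_tens1E.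
transitivity (\sum_j \sum_l c j *: (a ^+ (j == l) *:
     (X j l * \sum_i d i *: (L i j * L' l i))
   + (b *+ o l j) *: (X j j * \sum_i d i *: (L i l * L' l i)))).
  rewrite scaler_sumr.
  transitivity (\sum_i \sum_l \sum_j c j *: (d i *: (a ^+ (j == l) *:
     (X j l * (L i j * L' l i))
   + (b *+ o l j) *: (X j j * (L i l * L' l i))))).
    apply: eq_bigr => i _; rewrite mxE !scaler_sumr; apply: eq_bigr => l _.
    rewrite scalerA mulrC -scalerA scalerAl LXE mulr_suml scaler_sumr.
    apply: eq_bigr => j _; rewrite -scalerAl scalerA mulrC -scalerA.
    by congr (_ *: (_ *: _)); rewrite mulrDl -!scalerAl !mulrA.
  rewrite exchange_big [RHS]exchange_big; apply: eq_bigr => l _.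
  rewrite exchange_big; apply: eq_bigr => j _.
  rewrite -scaler_sumr; congr (_ *: _).
  under eq_bigr do rewrite scalerDr.
  rewrite big_split /= !mulr_sumr !scaler_sumr; congr (_ + _);
    apply: eq_bigr => i _; by rewrite -scalerAr !scalerA mulrC.
rewrite scaler_sumr; apply: eq_bigr => j _.
rewrite -scaler_sumr scalerA mulrC -scalerA; congr (_ *: _).
under eq_bigr do rewrite !hL' eqxx mulr1n -!scalerAr !mulr1.
rewrite big_split /= -(hd j) scalerDl; congr (_ + _).
  rewrite -(sum_mulrb_eq j (fun l => (a * d j) *: X j l)).
  apply: eq_bigr => l _.
  case: (eqVneq j l) => [<-|_]; first by rewrite !mulr1n expr1 scalerA.
  by rewrite !mulr0n scale0r scaler0.
rewrite mulr_sumr scaler_suml [RHS]big_mkcond; apply: eq_bigr => l _.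
by case: (o l j); rewrite scalerA ?mulr1n // mulr0n mul0r scale0r.
Qed.

End Commuting.
End Exchange.

(** The outer contraction of the relation between [L'] and [L] is, on one side,
    [kappa] times [L' L = 1]; the other side is a triangular system for the
    unknown sums [T k j], solved by induction along the order. *)
Lemma dual_inverse (K : fieldType) (A : algType K) n (a b kappa : K)
    (d : 'I_n -> K) (L L' : 'M[A]_n) :
  let B := braid A a b (fun i j : 'I_n => (i < j)%N) in
  a != 0 -> L' *m L = 1%:M ->
  tens2 L' *m B *m tens1 L = tens1 L *m B *m tens2 L' ->
  (forall x, a * d x + b * \sum_(i < n | (i < x)%N) d i = kappa) ->
  forall j k, \sum_i d i *: (L i j * L' k i) = (d j *+ (j == k))%:A.
Proof.
move=> B a0 L'L LBL hd j k.
pose T k j := \sum_i d i *: (L i j * L' k i).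
have TE k' j' : a ^+ (j' == k') *: T k' j'
    + (\sum_(x < n | (x < k')%N) b *: T x x) *+ (k' == j')
    = kappa *: (k' == j')%:R.
  have <- : (L' *m L) k' j' = (k' == j')%:R by rewrite L'L mxE.
  have := contract_tens2_tens1 a b (fun i j : 'I_n => (i < j)%N) d L' L k' j'.
  under [X in _ = X -> _]eq_bigr do rewrite hd.
  rewrite -scaler_sumr -/B mxE => <-; rewrite LBL.
  under [RHS]eq_bigr do rewrite tens1_braid_tens2E scalerDr.
  rewrite big_split /=; congr (_ + _).
    by rewrite scaler_sumr; apply: eq_bigr => i _; rewrite !scalerA mulrC.
  under [RHS]eq_bigr do rewrite -scalerMnr scaler_sumr.
  rewrite sumrMnl exchange_big /=; congr (_ *+ _); apply: eq_bigr => x _.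
  by rewrite scaler_sumr; apply: eq_bigr => i _; rewrite !scalerA mulrC.
rewrite -/(T k j); have [jk|jk] := eqVneq j k; last first.
  have := TE k j; rewrite [k == j]eq_sym (negPf jk) !mulr0n scaler0 addr0.
  by rewrite expr0 scale1r => ->; rewrite scale0r.
rewrite {j}jk mulr1n; case: k => k; elim/ltn_ind: k => k IH kn.
have := TE (Ordinal kn) (Ordinal kn); rewrite eqxx expr1 mulr1n.
rewrite (eq_bigr (fun x => (b * d x)%:A)) => [|[x xn] /= xk]; last first.
  by rewrite (IH _ xk) scalerA.
rewrite -(hd (Ordinal kn)) -scaler_suml -mulr_sumr scalerDl => /addIr.
by rewrite -scalerA => /(scalerI a0).
Qed.

(** * Quantum dimensions *)

Section Weights.
Variables (K : fieldType) (n : nat).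

(** The difference of two of the equations for [c]: the sum over the indices
    above [x] splits into those below [y], [y] itself, and those above
    [y]. *)
Lemma weight_between (a b kappa : K) (o : rel 'I_n) (c : 'I_n -> K) :
  irreflexive o -> antisymmetric o -> transitive o ->
  (forall x y, x != y -> o x y || o y x) -> a != 0 -> a - b = a^-1 ->
  (forall x, a * c x + b * \sum_(j | o x j) c j = kappa) ->
  forall x y, o x y ->
  c y * a^-1 = c x * a + b * \sum_(k | o x k && o k y) c k.
Proof.
move=> oirr oas otr otot a0 ab hc x y xy.
have onsym u v : o u v -> o v u = false.
  move=> uv; apply/negP=> vu; have euv : u = v by apply: oas; rewrite uv vu.
  by rewrite euv oirr in uv.
have split_sum : \sum_(j | o x j) c j =
    \sum_(k | o x k && o k y) c k + (c y + \sum_(j | o y j) c j).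
  rewrite (bigID (fun k => o k y)) /=; congr (_ + _).
  rewrite (bigD1 y) /=; last by rewrite xy oirr.
  congr (_ + _); apply: eq_bigl => k; case yk : (o y k).
    rewrite (otr _ _ _ xy yk) (onsym _ _ yk) /=.
    by apply/eqP=> e; rewrite e oirr in yk.
  have [->|ky] := eqVneq k y; first by rewrite andbF.
  by have := otot _ _ ky; rewrite yk orbF => ->; rewrite andbF.
have := hc x; rewrite split_sum -(hc y) -ab => e.
have -> : c y * (a - b) = a * c y + b * (\sum_(j | o y j) c j)
     - b * (c y + \sum_(j | o y j) c j) by ring.
by rewrite -e; ring.
Qed.

Variable q : K.
Hypothesis q0 : q != 0.

(** The diagonal entries of [D]. *)
Definition qdim (i : 'I_n) : K := q ^ (n%:Z - 1 - (2 * i)%:Z).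

Lemma telescope_below (f : nat -> K) (x : nat) : (x <= n)%N ->
  \sum_(j < n | (j < x)%N) (f j.+1 - f j) = f x - f 0%N.
Proof.
move=> xn; rewrite -(telescope_sumr f (leq0n x)) big_mkord.
by rewrite (big_ord_widen_cond _ predT (fun j => f j.+1 - f j) xn).
Qed.

Lemma telescope_above (f : nat -> K) (x : 'I_n) :
  \sum_(j < n | (x < j)%N) (f j.+1 - f j) = f n - f x.+1.
Proof.
have tot := telescope_below f (leqnn n).
rewrite (eq_bigl predT) in tot; last by move=> j; rewrite ltn_ord.
rewrite (bigID (fun j : 'I_n => (j < x.+1)%N)) /= telescope_below // in tot.
move: tot; rewrite (eq_bigl (fun j : 'I_n => (x < j)%N)) => [e|j].
  by apply: (addrI (f x.+1 - f 0%N)); rewrite e; ring.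
by rewrite -leqNgt.
Qed.

Lemma qdimV i : (qdim i)^-1 = q ^ ((2 * i)%:Z + 1 - n%:Z).
Proof. by rewrite /qdim invr_expz; congr (_ ^ _); ring. Qed.

Let f (j : nat) : K := q ^ ((2 * j)%:Z - n%:Z).
Let g (j : nat) : K := q ^ (n%:Z - (2 * j)%:Z).

Let mulq k : q * q ^ k = q ^ (k + 1).
Proof. by rewrite expfzDr // expr1z mulrC. Qed.

Let divq k : q^-1 * q ^ k = q ^ (k - 1).
Proof. by rewrite expfzDr // exprN1 mulrC. Qed.

Let f_step (j : 'I_n) : (q - q^-1) * (qdim j)^-1 = f j.+1 - f j.
Proof.
rewrite qdimV mulrBl mulq divq /f mulnS PoszD.
by congr (q ^ _ - q ^ _); ring.
Qed.

Let g_step (j : 'I_n) : (q - q^-1) * qdim j = - (g j.+1 - g j).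
Proof.
rewrite /qdim mulrBl mulq divq /g mulnS PoszD opprB.
by congr (q ^ _ - q ^ _); ring.
Qed.

(** All four weight sums telescope, since [(q - q^-1) q^k] is
    [q^(k + 1) - q^(k - 1)] and consecutive weights differ by a factor
    [q^2]. *)
Lemma qdimV_above x : q * (qdim x)^-1
  + (q - q^-1) * \sum_(j < n | (x < j)%N) (qdim j)^-1 = q ^+ n.
Proof.
rewrite mulr_sumr (eq_bigr _ (fun j _ => f_step j)) telescope_above.
rewrite qdimV mulq -[X in X + _](_ : f x.+1 = _); first last.
  by rewrite /f mulnS PoszD; congr (_ ^ _); ring.
by rewrite addrC subrK /f mul2n -addnn PoszD addrK.
Qed.

Lemma qdimV_below x : q^-1 * (qdim x)^-1
  + - (q - q^-1) * \sum_(j < n | (j < x)%N) (qdim j)^-1 = q^-1 ^+ n.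
Proof.
rewrite mulNr mulr_sumr (eq_bigr _ (fun j _ => f_step j)).
rewrite (telescope_below _ (ltnW (ltn_ord x))) qdimV divq.
rewrite -[X in X + _](_ : f x = _); last by rewrite /f; congr (_ ^ _); ring.
by rewrite opprB addrC subrK /f muln0 sub0r exprVn exprnN.
Qed.

Lemma qdim_below x : q * qdim x
  + (q - q^-1) * \sum_(i < n | (i < x)%N) qdim i = q ^+ n.
Proof.
rewrite mulr_sumr (eq_bigr _ (fun j _ => g_step j)) sumrN.
rewrite (telescope_below _ (ltnW (ltn_ord x))) /qdim mulq.
rewrite -[X in X + _](_ : g x = _); last by rewrite /g; congr (_ ^ _); ring.
by rewrite opprB addrC subrK /g muln0 subr0.
Qed.

Lemma qdim_above x : q^-1 * qdim x
  + - (q - q^-1) * \sum_(i < n | (x < i)%N) qdim i = q^-1 ^+ n.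
Proof.
rewrite mulNr mulr_sumr (eq_bigr _ (fun j _ => g_step j)) sumrN opprK.
rewrite telescope_above /qdim divq.
rewrite -[X in X + _](_ : g x.+1 = _); last first.
  by rewrite /g mulnS PoszD; congr (_ ^ _); ring.
rewrite addrC subrK /g mul2n -addnn PoszD opprD addrA subrr sub0r.
by rewrite exprVn exprnN.
Qed.

End Weights.

(** * The RLL relations *)

Lemma expmx_conj (A : nzRingType) n (L L' N : 'M[A]_n) m :
  L *m L' = 1%:M -> L' *m L = 1%:M ->
  (N *m L') ^+ m = L *m (L' *m N) ^+ m *m L'.
Proof.
move=> LK LV; elim: m => [|m IH]; first by rewrite !expr0 mulmx1 LK.
rewrite !exprS IH -[_ * (L *m _ *m _)]/(_ *m _) -[_ * _ ^+ m]/(_ *m _).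
by rewrite !mulmxA -[N *m L' *m L]mulmxA LV mulmx1 LK mul1mx.
Qed.

Section RLL.
Variables (K : fieldType) (A : algType K) (n : nat) (q : K).
Hypothesis q0 : q != 0.
Let h := q - q^-1.
Let R := braid A q h (fun i k : 'I_n => (i < k)%N).
Let R21 := braid A q h (fun i k : 'I_n => (k < i)%N).
Let R21inv := braid A q^-1 (- h) (fun i k : 'I_n => (k < i)%N).

Lemma lt_ord_irr : irreflexive (fun i k : 'I_n => (i < k)%N).
Proof. by move=> i; rewrite /= ltnn. Qed.
Lemma lt_ord_asym : antisymmetric (fun i k : 'I_n => (i < k)%N).
Proof. by move=> i k; rewrite ltnNge andbC; case: ltngtP. Qed.
Lemma lt_ord_trans : transitive (fun i k : 'I_n => (i < k)%N).
Proof. by move=> i k j; apply: ltn_trans. Qed.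
Lemma lt_ord_total (i k : 'I_n) : i != k -> (i < k)%N || (k < i)%N.
Proof. by rewrite -val_eqE; case: ltngtP. Qed.

Let R21_invr : R21 *m R21inv = 1%:M.
Proof.
apply: braid_mulV => // [i k|i]; last exact: lt_ord_irr.
by rewrite andbC; apply: lt_ord_asym.
Qed.

Let R21_invl : R21inv *m R21 = 1%:M.
Proof.
rewrite /R21 -[q in X in _ *m X]invrK -[h in X in _ *m X]opprK.
apply: braid_mulV => // [|i k|i]; last exact: lt_ord_irr.
  by rewrite invr_eq0.
by rewrite andbC; apply: lt_ord_asym.
Qed.

(** Multiply both sides of the hypothesis by [Z'] on the left and on the
    right. *)
Lemma mulmx_swap_inv (Y Z Z' S : 'M[A]_(n * n)) :
  Z *m Z' = 1%:M -> Z' *m Z = 1%:M ->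
  S *m Y *m Z = Z *m Y *m S -> Z' *m S *m Y = Y *m S *m Z'.
Proof.
move=> ZZ' Z'Z e; rewrite -[LHS]mulmx1 -ZZ' !mulmxA.
rewrite -[Z' *m S *m Y *m Z]mulmxA -[Z' *m S *m _]mulmxA [S *m _]mulmxA e.
by rewrite !mulmxA Z'Z mul1mx.
Qed.

Lemma tens2_comm_exp (M : 'M[A]_n) (Y : 'M[A]_(n * n)) m :
  tens2 M *m Y = Y *m tens2 M -> tens2 (M ^+ m) *m Y = Y *m tens2 (M ^+ m).
Proof.
move=> e; elim: m => [|m IH]; first by rewrite expr0 tens2_1 mul1mx mulmx1.
by rewrite exprS tens2M -mulmxA IH mulmxA e mulmxA.
Qed.

Lemma tens2_comm_inv (M M' : 'M[A]_n) (Y : 'M[A]_(n * n)) :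
  M *m M' = 1%:M -> M' *m M = 1%:M ->
  tens2 M *m Y = Y *m tens2 M -> tens2 M' *m Y = Y *m tens2 M'.
Proof.
move=> MM' M'M e; rewrite -[LHS]mulmx1 -tens2_1 -MM' tens2M !mulmxA.
by rewrite -[_ *m Y *m _]mulmxA -e !mulmxA -tens2M M'M tens2_1 mul1mx.
Qed.

Variables Lp Lm Lp' Lm' : 'M[A]_n.
Hypotheses (LpK : Lp *m Lp' = 1%:M) (LpV : Lp' *m Lp = 1%:M).
Hypotheses (LmK : Lm *m Lm' = 1%:M) (LmV : Lm' *m Lm = 1%:M).
Hypothesis RLpLp :
  R *m tens1 Lp *m tens2 Lp = tens2 Lp *m tens1 Lp *m R.
Hypothesis RLmLm :
  R *m tens1 Lm *m tens2 Lm = tens2 Lm *m tens1 Lm *m R.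
Hypothesis RLpLm :
  R *m tens1 Lp *m tens2 Lm = tens2 Lm *m tens1 Lp *m R.

Let M := Lm' *m Lp.
Let M' := Lp' *m Lm.

Let MM' : M *m M' = 1%:M.
Proof. by rewrite /M /M' mulmxA -[_ *m Lp *m _]mulmxA LpK mulmx1 LmV. Qed.
Let M'M : M' *m M = 1%:M.
Proof. by rewrite /M /M' mulmxA -[_ *m Lm *m _]mulmxA LmK mulmx1 LpV. Qed.

Let t2K (X Y : 'M[A]_n) :
  X *m Y = 1%:M -> tens2 X *m tens2 Y = 1%:M.
Proof. by move=> e; rewrite -tens2M e tens2_1. Qed.

Let t1K (X Y : 'M[A]_n) :
  X *m Y = 1%:M -> tens1 X *m tens1 Y = 1%:M.
Proof. by move=> e; rewrite -tens1M e tens1_1. Qed.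

(** Move [L^+_1] through [L^+_2] by the RLL relation, then through
    [(L^-_2)^-1] by the mixed relation solved for the inverse; both steps
    involve the same matrix [R]. *)
Lemma comm_M_Lplus :
  tens2 M *m (tens1 Lp *m R) = tens1 Lp *m R *m tens2 M.
Proof.
have e := mulmx_swap_inv (t2K LmK) (t2K LmV) RLpLm.
rewrite tens2M -mulmxA [tens2 Lp *m _]mulmxA -RLpLp.
by rewrite !mulmxA e.
Qed.

(** The relation seen from the exchanged tensor factors, multiplied by the
   inverse of the flipped R-matrix on both sides. *)
Let flip_RLL X Y : R *m tens1 X *m tens2 Y = tens2 Y *m tens1 X *m R ->
  tens2 X *m tens1 Y *m R21inv = R21inv *m tens1 Y *m tens2 X.
Proof.
move=> /(congr1 (@flip_mx A n)).
rewrite !flip_mxM !flip_tens1 !flip_tens2 flip_braid -/R21 => e.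
rewrite -[LHS]mul1mx -R21_invl -!mulmxA; congr (_ *m _).
by rewrite !mulmxA e -mulmxA R21_invr mulmx1.
Qed.

(** As for [L^+], after the flip: in the mixed relation it is then [L^-] that
    carries the index 1. *)
Lemma comm_M_Lminus :
  tens2 M *m (tens1 Lm *m R21inv) = tens1 Lm *m R21inv *m tens2 M.
Proof.
have e := mulmx_swap_inv (t2K LmK) (t2K LmV) (esym (flip_RLL RLmLm)).
rewrite tens2M -mulmxA [tens2 Lp *m _]mulmxA (flip_RLL RLpLm).
by rewrite !mulmxA e.
Qed.

Lemma comm_Minv_Lplus :
  tens2 M' *m (tens1 Lp *m R) = tens1 Lp *m R *m tens2 M'.
Proof. exact: tens2_comm_inv MM' M'M comm_M_Lplus. Qed.

Lemma comm_Minv_Lminus :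
  tens2 M' *m (tens1 Lm *m R21inv) = tens1 Lm *m R21inv *m tens2 M'.
Proof. exact: tens2_comm_inv MM' M'M comm_M_Lminus. Qed.

(** Commuting with an invertible matrix amounts to commuting with its
    inverse. *)
Lemma comm_inv_Lminus X :
  tens2 X *m (tens1 Lm *m R21inv) = tens1 Lm *m R21inv *m tens2 X ->
  tens2 X *m R21 *m tens1 Lm' = R21 *m tens1 Lm' *m tens2 X.
Proof.
move=> e.
have YK : tens1 Lm *m R21inv *m (R21 *m tens1 Lm') = 1%:M.
  by rewrite mulmxA -[_ *m R21inv *m _]mulmxA R21_invl mulmx1 t1K.
have YV : R21 *m tens1 Lm' *m (tens1 Lm *m R21inv) = 1%:M.
  by rewrite mulmxA -[_ *m tens1 Lm' *m _]mulmxA (t1K LmV) mulmx1.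
rewrite -mulmxA -[LHS]mul1mx -YV.
rewrite -[_ *m _ *m (tens2 X *m _)]mulmxA [_ *m _ *m (tens2 X *m _)]mulmxA.
by rewrite -e -[X in _ *m X]mulmxA YK mulmx1.
Qed.

Let c (i : 'I_n) := (qdim q i)^-1.

Lemma trace_central X :
  tens2 X *m (tens1 Lp *m R) = tens1 Lp *m R *m tens2 X ->
  tens2 X *m (tens1 Lm *m R21inv) = tens1 Lm *m R21inv *m tens2 X ->
  forall i j, let z := \sum_k c k *: X k k in
  z * Lp i j = Lp i j * z /\ z * Lm i j = Lm i j * z.
Proof.
move=> eXp eXm i j z; split.
  apply: (exchange_central eXp) => //.
  - exact: lt_ord_asym.
  - exact: lt_ord_trans.
  apply: (@weight_between _ _ q h (q ^+ n)) => //.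
  - exact: lt_ord_asym.
  - exact: lt_ord_trans.
  - exact: lt_ord_total.
  - by rewrite /h opprB addrC subrK.
  - exact: qdimV_above.
have gt_asym : antisymmetric (fun i k : 'I_n => (k < i)%N).
  by move=> x y; rewrite andbC; apply: lt_ord_asym.
have gt_trans : transitive (fun i k : 'I_n => (k < i)%N).
  by move=> x y k xy yk; apply: ltn_trans yk xy.
apply: (exchange_central eXm) => //.
- by rewrite invr_eq0.
- exact: lt_ord_irr.
apply: (@weight_between _ _ q^-1 (- h) (q^-1 ^+ n)) => //.
- exact: lt_ord_irr.
- by move=> x y xy; rewrite orbC lt_ord_total.
- by rewrite invr_eq0.
- by rewrite /h opprK invrK addrC subrK.
- exact: qdimV_below.
Qed.

Let dual_Lplus j k :
  \sum_i qdim q i *: (Lp i j * Lp' k i) = (qdim q j *+ (j == k))%:A.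
Proof.
apply: (@dual_inverse K A n q h (q ^+ n)) => //; last exact: qdim_below.
exact: mulmx_swap_inv (t2K LpK) (t2K LpV) RLpLp.
Qed.

Let dual_Lminus j k :
  \sum_i qdim q i *: (Lm i j * Lm' k i) = (qdim q j *+ (j == k))%:A.
Proof.
apply: (@dual_inverse K A n q h (q ^+ n)) => //; last exact: qdim_below.
exact: mulmx_swap_inv (t2K LmK) (t2K LmV) RLmLm.
Qed.

Lemma trace_conj_Lplus X :
  tens2 X *m (tens1 Lp *m R) = tens1 Lp *m R *m tens2 X ->
  \sum_i qdim q i *: (Lp *m X *m Lp') i i = \sum_k c k *: X k k.
Proof.
move=> e; apply: (exchange_trace e (kappa := q ^+ n)) => //.
- by rewrite expf_neq0.
- exact: qdimV_above.
- exact: qdim_below.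
Qed.

Lemma trace_conj_Lminus X :
  tens2 X *m (tens1 Lm *m R21inv) = tens1 Lm *m R21inv *m tens2 X ->
  \sum_i qdim q i *: (Lm *m X *m Lm') i i = \sum_k c k *: X k k.
Proof.
move=> e; apply: (exchange_trace e (kappa := q^-1 ^+ n)) => //.
- by rewrite expf_neq0 // invr_eq0.
- exact: qdimV_below.
- exact: qdim_above.
Qed.

Lemma trace_exp_Minv m :
  \sum_i qdim q i *: ((Lm *m Lp') ^+ m) i i = \sum_k c k *: (M' ^+ m) k k.
Proof.
rewrite (expmx_conj _ _ LpK LpV); apply: trace_conj_Lplus.
exact: tens2_comm_exp comm_Minv_Lplus.
Qed.

Lemma trace_exp_M m :
  \sum_i qdim q i *: ((Lp *m Lm') ^+ m) i i = \sum_k c k *: (M ^+ m) k k.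
Proof.
rewrite (expmx_conj _ _ LmK LmV); apply: trace_conj_Lminus.
exact: tens2_comm_exp comm_M_Lminus.
Qed.

(** In every product on the right the entries of [X] come last, so that they
    act first on a vector. *)
Lemma mulmx_Lminus_inv X k j :
  tens2 X *m (tens1 Lm *m R21inv) = tens1 Lm *m R21inv *m tens2 X ->
  q ^+ n *: (X *m Lm') k j = \sum_i c i *:
    (q ^+ (i == k) *: (Lm' i j * X k i)
     + (h *+ (k < i)%N) *: (Lm' k j * X i i)).
Proof.
move=> e.
have := contract_tens2_tens1 q h (fun i k : 'I_n => (k < i)%N) c X Lm' k j.
have hc x : q * c x + h * \sum_(i < n | (x < i)%N) c i = q ^+ n.
  exact: qdimV_above.
under [X in _ = X -> _]eq_bigr do rewrite hc.
rewrite -scaler_sumr => XE; rewrite [(X *m Lm') k j]mxE -XE.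
apply: eq_bigr => i _; congr (_ *: _).
rewrite -/R21 (comm_inv_Lminus e) -mulmxA mul_braidE.
by rewrite !tens1_tens2E.
Qed.

End RLL.

(** * The symmetric function of the eigenvalues *)

(** The value at the list [s] of variables of the polynomial whose generating
    function [G_s(u) = sum_m g(m) u^m] satisfies, for [qi] inverse to [q],
    [(1 - y u) G_(y :: s) = (q - qi y u) G_s + qi ^ (size s)]. *)
Fixpoint gelfand_sum (A : comNzRingType) (q qi : A) (s : seq A) : nat -> A :=
  if s is y :: s' then
    fix g m := if m is m'.+1 then
        y * g m' + (q * gelfand_sum q qi s' m - qi * y * gelfand_sum q qi s' m')
      else qi ^+ size s' + q * gelfand_sum q qi s' 0
  else fun=> 0.
Arguments gelfand_sum : simpl never.

Section GelfandSum.
Variables (A : comNzRingType) (q qi : A).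
Hypothesis qqi : q * qi = 1.
Local Notation g := (gelfand_sum q qi).

Lemma gelfand_sum0 y s : g (y :: s) 0 = qi ^+ size s + q * g s 0.
Proof. by []. Qed.

Lemma gelfand_sumS y s m :
  g (y :: s) m.+1 = y * g (y :: s) m + (q * g s m.+1 - qi * y * g s m).
Proof. by []. Qed.

(** Multiplying by [(1 - y u) (1 - z u)] brings the generating functions of
    both sides to the same form.  On coefficients this is a recursion of order
    two, whence the two initial cases. *)
Lemma gelfand_sum_swap y z s m : g [:: y, z & s] m = g [:: z, y & s] m.
Proof.
have qiq : qi * q = 1 by rewrite mulrC.
elim/ltn_ind: m => -[_|[_|m IH]].
- by rewrite !gelfand_sum0.
- rewrite !gelfand_sumS !gelfand_sum0 /= exprS; ring: qqi.
- have e1 := IH m.+1 (ltnSn _); have e0 := IH m (leqnSn _).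
  move: (gelfand_sumS y (z :: s) m) (gelfand_sumS z (y :: s) m); rewrite e1 e0 => h1 h2.
  rewrite gelfand_sumS [g [:: z, y & s] _]gelfand_sumS e1.
  rewrite !(gelfand_sumS _ s) in h1 h2 *.
  move: (g [:: z, y & s] m.+1) (g [:: z, y & s] m) h1 h2 => G1 G0 h1 h2.
  move: (g s m.+2) (g s m.+1) (g s m) (g (y :: s) m) (g (z :: s) m) h1 h2.
  move=> a2 a1 a0 c b h1 h2.
  have h : y * G1 - z * G1 =
    y * (z * G0 + (q * (y * c + (q * a1 - qi * y * a0)) - qi * z * c))
    - z * (y * G0 + (q * (z * b + (q * a1 - qi * z * a0)) - qi * y * b)).
    by rewrite -h1 -h2.
  apply/eqP; rewrite -subr_eq0; apply/eqP.
  rewrite -[RHS](subrr (y * G1 - z * G1)) [in X in _ = _ - X]h.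
  ring: qqi.
Qed.

Lemma gelfand_sum_insert s1 y s2 m : g (s1 ++ y :: s2) m = g (y :: s1 ++ s2) m.
Proof.
elim: s1 m => [//|x s1 IH] m; rewrite cat_cons -[RHS]gelfand_sum_swap.
elim: m => [|m IHm]; first by rewrite !(gelfand_sum0 x) IH /= !size_cat /= addnS.
by rewrite !(gelfand_sumS x) IHm !IH.
Qed.

Lemma gelfand_sum_perm s t m : perm_eq s t -> g s m = g t m.
Proof.
elim: s t m => [|x s IH] t m; first by rewrite perm_sym => /perm_nilP ->.
move=> st; have xt : x \in t by rewrite -(perm_mem st) mem_head.
case/splitPr: xt st => t1 t2; rewrite gelfand_sum_insert => st.
have {}st : perm_eq s (t1 ++ t2).
  rewrite -(perm_cons x) (perm_trans st) //.
  by rewrite -cat_rcons -cats1 -catA perm_catCA.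
elim: m => [|m IHm]; last by rewrite !gelfand_sumS IHm !(IH _ _ st).
by rewrite !gelfand_sum0 (perm_size st) (IH _ _ st).
Qed.

(** This is the form in which the recursion comes from the representation,
    with [w m k] the contribution of the [k]-th diagonal entry.  The initial
    value is [c q ^ (2 k + 1 - n)]; the constant [c] lets the induction remove
    the first variable, which multiplies the remaining initial values by
    [q]. *)
Lemma gelfand_sum_rec n (y : 'I_n -> A) (w : nat -> 'I_n -> A) c :
  (forall k : 'I_n, w 0 k = c * q ^+ k * qi ^+ (n - k.+1)) ->
  (forall m k, w m.+1 k =
     y k * (w m k + (1 - qi ^+ 2) * \sum_(i < n | (k < i)%N) w m i)) ->
  forall m, \sum_k w m k = c * g [seq y k | k <- enum 'I_n] m.
Proof.
elim: n y w c => [|n IH] y w c w0 wS m.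
  by rewrite big_ord0 enum_ord0 mulr0.
have IH' m' : \sum_(k < n) w m' (lift ord0 k)
    = c * q * g [seq y (lift ord0 k) | k <- enum 'I_n] m'.
  apply: (IH _ (fun m k => w m (lift ord0 k))) => [k|{}m' k].
    by rewrite w0 /= /bump /= add1n exprS mulrA subSS.
  by rewrite wS big_mkcond big_ord_recl /= add0r -big_mkcond.
rewrite enum_ordSl /= -map_comp.
elim: m => [|m IHm]; rewrite big_ord_recl IH'.
  by rewrite w0 gelfand_sum0 size_map size_enum_ord subSS subn0 expr0; ring.
have tailE : \sum_(i < n.+1 | (@ord0 n < i)%N) w m i
    = \sum_(k < n) w m (lift ord0 k).
  by rewrite big_mkcond big_ord_recl /= add0r.
rewrite wS tailE gelfand_sumS IH'.
have -> : w m ord0 = c * g (y ord0 :: [seq y (lift ord0 k) | k <- enum 'I_n]) m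
    - c * q * g [seq y (lift ord0 k) | k <- enum 'I_n] m.
  by rewrite -IHm big_ord_recl IH' addrK.
rewrite /comp; ring: qqi.
Qed.

End GelfandSum.

Lemma gelfand_sum_rmorph (A B : comNzRingType) (f : {rmorphism A -> B}) q qi s m :
  f (gelfand_sum q qi s m) = gelfand_sum (f q) (f qi) (map f s) m.
Proof.
elim: s m => [|y s IH] m; first exact: rmorph0.
elim: m => [|m IHm] /=.
  by rewrite !gelfand_sum0 rmorphD rmorphM rmorphXn /= IH size_map.
by rewrite !gelfand_sumS rmorphD rmorphB !rmorphM IHm !IH.
Qed.

Section GelfandSumFormula.
Variables (K : fieldType) (q : K).
Hypothesis q0 : q != 0.
Let h := q - q^-1.

(** The coefficient of [y k ^+ m] in the formula for the eigenvalues. *)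
Definition gelfand_sum_weight n (y : 'I_n -> K) (k : 'I_n) : K :=
  \prod_(i < n | i != k) ((q^-1 * y i - q * y k) / (y i - y k)).

Lemma gelfand_sum_weight_lift n (y : 'I_n.+1 -> K) (k : 'I_n) :
  gelfand_sum_weight y (lift ord0 k) =
  (q^-1 * y ord0 - q * y (lift ord0 k)) / (y ord0 - y (lift ord0 k))
  * gelfand_sum_weight (y \o lift ord0) k.
Proof.
rewrite /gelfand_sum_weight big_mkcond big_ord_recl /=; congr (_ * _).
by rewrite [RHS]big_mkcond; apply: eq_bigr => i _; rewrite (inj_eq lift_inj).
Qed.

Lemma gelfand_sum_weight0 n (y : 'I_n.+1 -> K) :
  gelfand_sum_weight y ord0 =
  \prod_(i < n) ((q^-1 * y (lift ord0 i) - q * y ord0)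
                  / (y (lift ord0 i) - y ord0)).
Proof. by rewrite /gelfand_sum_weight big_mkcond big_ord_recl /= mul1r. Qed.

(** The partial fraction expansion, in the variable [z], of the product.
    Adding the variable [y ord0] needs the weight of [y ord0] itself, which is
    the same product over the old variables at [z = y ord0], so the induction
    hypothesis evaluates it. *)
Lemma prod_partial_fractions n (y : 'I_n -> K) z :
  injective y -> (forall i, y i != z) ->
  \prod_(i < n) ((q^-1 * y i - q * z) / (y i - z)) =
  q^-1 ^+ n + h * z * \sum_k gelfand_sum_weight y k / (z - y k).
Proof.
elim: n y z => [|n IH] y z yinj yz; first by rewrite !big_ord0 expr0 mulr0 addr0.
have y'inj : injective (y \o lift ord0) by apply: inj_comp yinj lift_inj.
have yy0 i : y (lift ord0 i) != y ord0.
  by rewrite (inj_eq yinj) eq_sym neq_lift.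
have {}yz i : y i != z by apply: yz.
have /= IHz := IH _ z y'inj (fun i => yz _).
have /= IH0 := IH _ (y ord0) y'inj yy0.
rewrite !big_ord_recl gelfand_sum_weight0 IHz IH0.
have yz0 : z - y ord0 != 0 by rewrite subr_eq0 eq_sym yz.
have zy0 : y ord0 - z != 0 by rewrite subr_eq0 yz.
rewrite mulrDr.
have -> : (q^-1 * y ord0 - q * z) / (y ord0 - z) *
    (h * z * \sum_k gelfand_sum_weight (y \o lift ord0) k / (z - y (lift ord0 k)))
  = h * z * (h * y ord0 * (\sum_k gelfand_sum_weight (y \o lift ord0) k
                                    / (y ord0 - y (lift ord0 k))) / (z - y ord0)
    + \sum_k gelfand_sum_weight y (lift ord0 k) / (z - y (lift ord0 k))).
  rewrite !mulr_sumr mulr_suml -big_split mulr_sumr; apply: eq_bigr => k _ /=.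
  rewrite gelfand_sum_weight_lift.
  have yk : y ord0 - y (lift ord0 k) != 0 by rewrite subr_eq0 eq_sym.
  have zk : z - y (lift ord0 k) != 0 by rewrite subr_eq0 eq_sym yz.
  by rewrite /h; field; rewrite q0 zy0 yz0 yk zk.
by rewrite exprS /h; field; rewrite q0 zy0 yz0.
Qed.

(** Induction on the number of variables and on [m].  The step in [m] is the
    cancellation of the factor [y ord0 - y k] against a denominator; the case
    [m = 0], where the weights add up to a q-number, uses partial fractions at
    [z = y ord0] for the weight of the new variable. *)
Lemma gelfand_sum_formula n (y : 'I_n -> K) m : injective y ->
  \sum_k y k ^+ m * gelfand_sum_weight y k =
  gelfand_sum q q^-1 [seq y k | k <- enum 'I_n] m.
Proof.
elim: n y m => [|n IH] y m yinj; first by rewrite big_ord0 enum_ord0.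
have y'inj : injective (y \o lift ord0) by apply: inj_comp yinj lift_inj.
have y0k k : y ord0 - y (lift ord0 k) != 0.
  by rewrite subr_eq0 (inj_eq yinj) neq_lift.
rewrite enum_ordSl /= -map_comp.
elim: m => [|m IHm].
  rewrite gelfand_sum0 size_map size_enum_ord -(IH (y \o lift ord0)) //.
  rewrite big_ord_recl gelfand_sum_weight0 prod_partial_fractions //; last first.
    by move=> i /=; rewrite (inj_eq yinj) eq_sym neq_lift.
  rewrite expr0 mul1r -addrA; congr (_ + _).
  rewrite !mulr_sumr -big_split; apply: eq_bigr => k _ /=.
  rewrite gelfand_sum_weight_lift !expr0 /h; have := y0k k => yk.
  by field; rewrite q0 yk.
rewrite gelfand_sumS -IHm -!(IH (y \o lift ord0)) // !big_ord_recl !mulrDr.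
rewrite exprS !mulrA -addrA; congr (_ + _).
rewrite !mulr_sumr -sumrB -big_split; apply: eq_bigr => k _ /=.
rewrite gelfand_sum_weight_lift exprS; have := y0k k => yk.
by field; rewrite q0 yk.
Qed.
End GelfandSumFormula.

(** * The quantized enveloping algebra *)

Lemma map_RLL_diff n (A B : nzRingType) (f : {rmorphism A -> B})
    (r : 'M[A]_(n * n)) (X Y : 'M[A]_n) :
  map_mx f (r *m tens1 X *m tens2 Y - tens2 Y *m tens1 X *m r) =
  map_mx f r *m tens1 (map_mx f X) *m tens2 (map_mx f Y)
  - tens2 (map_mx f Y) *m tens1 (map_mx f X) *m map_mx f r.
Proof. by rewrite map_mxB !map_mxM !map_mxT !map_mx1. Qed.

Section UqFacts.
Variables (K : fieldType) (n : nat) (q : K).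
Local Notation U := (Uq n q).

Lemma RmatrixE (i j k l : 'I_n) : Rmatrix n q <|i, k|> <|j, l|> =
  q ^+ (i == k) *+ ((i == j) && (k == l))
  + (q - q^-1) *+ [&& (i < k)%N, i == l & k == j].
Proof.
have deltaE (a b c d : 'I_n) :
    (@delta_mx K n n a b *t delta_mx c d) <|i, k|> <|j, l|>
    = [&& j == b, k == c & l == d]%:R *+ (i == a).
  rewrite tensmxE !mxE -natrM mulnb -!andbA.
  by case: (i == a); rewrite ?mulr0n ?mulr1n.
rewrite /Rmatrix !mxE !summxE.
under eq_bigr do rewrite deltaE.
under [X in _ + X + _]eq_bigr => a _.
  rewrite summxE; under eq_bigr do rewrite deltaE.
  rewrite sumrMnl; over.
under [X in _ + _ * X]eq_bigr => a _.
  rewrite summxE; under eq_bigr do rewrite deltaE.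
  rewrite sumrMnl; over.
rewrite !sum_mulrb_eq.
have pick (P Q : pred 'I_n) :
    \sum_(c | P c) (Q c && (k == c))%:R = (P k && Q k)%:R :> K.
  rewrite big_mkcond -(sum_mulrb_eq k (fun c => (P c && Q c)%:R)).
  apply: eq_bigr => c _; case: (P c); last by rewrite mul0rn.
  by case: (k == c); rewrite ?andbT ?andbF.
rewrite (eq_bigr (fun c => (((j == i) && (l == c)) && (k == c))%:R)); last first.
  by move=> c _ /=; rewrite [(k == c) && _]andbC andbA.
rewrite pick.
rewrite (eq_bigr (fun c => (((j == c) && (l == i)) && (k == c))%:R)); last first.
  by move=> c _ /=; rewrite [(k == c) && _]andbC andbA.
rewrite pick [j == i]eq_sym [l == k]eq_sym [l == i]eq_sym [j == k]eq_sym.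
congr (_ + _); last by rewrite [(k == j) && _]andbC mulr_natr.
rewrite [k == i]eq_sym; case: (eqVneq i k) => [->|_] /=.
  by rewrite addr0 mulr_natr.
by rewrite andbF mulr0 add0r.
Qed.

Lemma Uq_pi_scalar (c : K) : Uq_pi q (c%:A : free_alg K n) = c%:A :> U.
Proof. by rewrite Uq_piZ rmorph1. Qed.

Lemma map_free_R :
  map_mx (@Uq_pi K n q) (free_R n q) =
  braid U q (q - q^-1) (fun i k : 'I_n => (i < k)%N).
Proof.
apply/matrixP=> x y; case: (mxtens_indexP x) => i k.
case: (mxtens_indexP y) => j l.
by rewrite braidE -RmatrixE mxE [free_R _ _ _ _]mxE; apply: Uq_pi_scalar.
Qed.

Definition Lgen (s : bool) : 'M[U]_n := map_mx (@Uq_pi K n q) (free_L K n s).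

Lemma Uq_RLL s t : s || ~~ t -> 
  let R := braid U q (q - q^-1) (fun i k : 'I_n => (i < k)%N) in
  R *m tens1 (Lgen s) *m tens2 (Lgen t) = tens2 (Lgen t) *m tens1 (Lgen s) *m R.
Proof.
move=> st R; apply/eqP; rewrite -subr_eq0; apply/eqP.
rewrite /R -map_free_R -(map_RLL_diff (@Uq_pi K n q)).
apply/matrixP=> x y; rewrite [LHS]mxE [RHS]mxE; apply: Uq_rel0.
case: s t st => -[] // _.
- exact: rel_RLL.
- exact: rel_RLpLm.
- exact: rel_RLL.
Qed.

(** Every element is the image of a linear combination of words in the
    generators. *)
Lemma Uq_gen_central (z : U) :
  (forall s i j, z * Lgen s i j = Lgen s i j * z) -> forall u, z * u = u * z.
Proof.
move=> zL u; rewrite -(Uq_reprK u); move: (Uq_repr u) => x.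
have word (w : seq (generator n)) :
    z * Uq_pi q (mkmalgU (FMonom w) 1 : free_alg K n)
    = Uq_pi q (mkmalgU (FMonom w) 1 : free_alg K n) * z.
  elim: w => [|[s [i j]] w IH].
    rewrite -fmoneE; change (mkmalgU _ _) with (1 : free_alg K n).
    by rewrite rmorph1 mulr1 mul1r.
  have -> : mkmalgU (FMonom ((s, (i, j)) :: w)) 1 =
      free_gen K s i j * (mkmalgU (FMonom w) 1 : free_alg K n) :> free_alg K n.
    rewrite [RHS]fgmulUU mulr1; congr mkmalgU.
    by rewrite -[RHS]/(fmmul _ _) fmmulE fmuE.
  have e := zL s i j; rewrite !mxE in e.
  by rewrite rmorphM mulrA e -mulrA IH mulrA.
rewrite [x]monalgE raddf_sum mulr_sumr mulr_suml; apply: eq_bigr => w _.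
have -> : mkmalgU w (monalg.mcoeff w x) =
    monalg.mcoeff w x *: (mkmalgU w 1 : free_alg K n).
  by rewrite -mul_malgC [RHS]fgmulUU mulr1 mul1m.
rewrite /= Uq_piZ; change (Uq_scale ?c ?v) with (c *: v).
by rewrite -scalerAr -scalerAl -(fmK w) word.
Qed.

End UqFacts.

(** * The highest weight vector *)

Section HighestWeightVector.
Variables (K : fieldType) (A : algType K) (V : lmodType A) (xi : V).

(** For [A]-modules the scalars of [K] act through [A]. *)
Definition eigen (u : A) (s : K) : Prop := u *: xi = (s%:A : A) *: xi.

Lemma scalar_act (s : K) (u : A) (v : V) :
  u *: ((s%:A : A) *: v) = (s%:A : A) *: (u *: v).
Proof. by rewrite !scalerA -scalerAl -scalerAr mul1r mulr1. Qed.

Lemma eigen0 : eigen 0 0.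
Proof. by rewrite /eigen !scale0r. Qed.

Lemma eigen_scalar s : eigen s%:A s.
Proof. by []. Qed.

Lemma eigenD u v s t : eigen u s -> eigen v t -> eigen (u + v) (s + t).
Proof. by rewrite /eigen => us vt; rewrite !scalerDl us vt. Qed.

Lemma eigenZ c u s : eigen u s -> eigen (c *: u) (c * s).
Proof.
rewrite /eigen => us; rewrite -[u in LHS]mul1r scalerAl -scalerA us scalerA.
by rewrite -scalerAl mul1r scalerA.
Qed.

Lemma eigenM u v s t : eigen u s -> eigen v t -> eigen (u * v) (t * s).
Proof.
rewrite /eigen => us vt; rewrite -scalerA vt scalar_act us scalerA.
by rewrite -scalerAl mul1r scalerA.
Qed.

Lemma eigen_sum (I : finType) (F : I -> A) (s : I -> K) :
  (forall i, eigen (F i) (s i)) -> eigen (\sum_i F i) (\sum_i s i).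
Proof.
move=> Fs; apply: (big_ind2 eigen) => [|u s' v t us vt|i _].
- exact: eigen0.
- exact: eigenD.
- exact: Fs.
Qed.

Lemma eigen_unscale c u s : c != 0 -> eigen (c *: u) s -> eigen u (c^-1 * s).
Proof.
move=> c0 cu; have := eigenZ c^-1 cu.
by rewrite scalerA mulVf // scale1r.
Qed.

Variables (n : nat) (q : K) (Lp Lm Lm' : 'M[A]_n) (t : 'I_n -> K).
Hypotheses (q0 : q != 0) (t0 : forall i, t i != 0).
Hypothesis LmK : Lm *m Lm' = 1%:M.
Hypothesis Lm0 : forall i j : 'I_n, (i < j)%N -> Lm i j = 0.
Hypothesis Lp0 : forall i j : 'I_n, (j < i)%N -> Lp i j = 0.
Hypothesis LpLm : forall i, Lp i i * Lm i i = 1.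
Hypothesis Lp_xi : forall i j : 'I_n, (i < j)%N -> Lp i j *: xi = 0.
Hypothesis Lm_xi : forall i, eigen (Lm i i) (t i).

Lemma Lminus_inv_entries (i j : 'I_n) : (i <= j)%N ->
  Lm' i j = if i == j then Lp i i else 0.
Proof.
case: i => i; elim/ltn_ind: i => i IH ilt /= ij.
have := congr1 (fun X : 'M_n => X (Ordinal ilt) j) LmK.
rewrite mxE (bigD1 (Ordinal ilt)) //= big1 => [|k ki]; last first.
  have [ik|ki'|e] := ltngtP i k; last by rewrite -val_eqE /= e eqxx in ki.
    by rewrite Lm0 // mul0r.
  case: k ki ki' => k kn ki ki'.
  rewrite IH ?(leq_trans (ltnW ki')) //= ifN ?mulr0 //.
  by rewrite -val_eqE /= ltn_eqF // (leq_trans ki').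
rewrite addr0 mxE => /(congr1 (fun u => Lp (Ordinal ilt) (Ordinal ilt) * u)).
by rewrite mulrA LpLm mul1r; case: eqP => _ ->; rewrite ?mulr1 ?mulr0.
Qed.

Lemma eigen_Lplus i : eigen (Lp i i) (t i)^-1.
Proof.
have e : xi = Lp i i *: (((t i)%:A : A) *: xi).
  by rewrite -Lm_xi scalerA LpLm scale1r.
rewrite /eigen {2}e scalar_act scalerA -scalerAl mul1r [(t i)^-1 *: _]scalerA.
by rewrite mulVf // scale1r scale1r.
Qed.

Let M := Lm' *m Lp.
Let c (i : 'I_n) := (qdim q i)^-1.
Let h := q - q^-1.
Hypothesis Mexch : forall m k j,
  q ^+ n *: ((M ^+ m) *m Lm') k j = \sum_i c i *:
    (q ^+ (i == k) *: (Lm' i j * (M ^+ m) k i)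
     + (h *+ (k < i)%N) *: (Lm' k j * (M ^+ m) i i)).

(** The eigenvalue of [(M ^+ m) k k] on [xi]. *)
Fixpoint diag_eigen (m : nat) (k : 'I_n) : K :=
  if m is m'.+1 then
    (q ^+ n)^-1 * t k ^- 2
    * (q * (c k * diag_eigen m' k)
       + h * \sum_(i < n | (k < i)%N) c i * diag_eigen m' i)
  else 1.

(** Write [M^(m+1)] as [(M^m L') Lp], where only the diagonal entry of the
    [j]-th column of [Lp] does not kill [xi].  In the formula for [M^m L'] the
    terms with [i <> k] are zero: either [M^m k i] kills [xi], by induction,
    or the entry of the lower triangular matrix [L'] vanishes; what is left
    are the diagonal entries of [M^m]. *)
Lemma eigen_M_exp m (k j : 'I_n) : (k <= j)%N ->
  eigen ((M ^+ m) k j) (if k == j then diag_eigen m k else 0).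
Proof.
elim: m k j => [|m IH] k j kj.
  rewrite expr0 mxE; case: eqP => _; last exact: eigen0.
  by rewrite mulr1n -[X in eigen X]scale1r; apply: eigen_scalar.
have XL : eigen ((M ^+ m *m Lm') k j)
    (if k == j then t k * diag_eigen m.+1 k else 0).
  have -> : (if k == j then t k * diag_eigen m.+1 k else 0) = (q ^+ n)^-1 *
      \sum_i c i * (q ^+ (i == k) * ((if (k == i) then diag_eigen m k else 0)
                                      * (if (i == j) then (t j)^-1 else 0))
        + (h *+ (k < i)%N) * (diag_eigen m i
                              * (if k == j then (t j)^-1 else 0))).
    case: (eqVneq k j) => [<-|kj'] /=; last first.
      rewrite big1 ?mulr0 // => i _; rewrite !mulr0 addr0.
      case: (eqVneq k i) => [<-|_]; last by rewrite mul0r !mulr0.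
      by rewrite (negPf kj') !mulr0.
    rewrite exprS invfM [in RHS](eq_bigr (fun i =>
       (t k)^-1 * ((q * (c k * diag_eigen m k)) *+ (k == i)
        + (if (k < i)%N then h * (c i * diag_eigen m i) else 0)))); last first.
      move=> i _; case: (eqVneq k i) => [<-|ki].
        by rewrite ltnn /= ?mulr0n ?mulr1n ?expr1; ring.
      by case: ltnP => _ /=; rewrite ?mulr0n ?mulr1n; ring.
    rewrite -mulr_sumr big_split /= sum_mulrb_eq -big_mkcond /= -mulr_sumr.
    by rewrite !mulrA; congr (_ * _); field; rewrite t0 expf_neq0.
  apply: eigen_unscale; first by rewrite expf_neq0.
  rewrite Mexch; apply: eigen_sum => i; apply: eigenZ; apply: eigenD.
    apply: eigenZ.
    have [ki|ik] := leqP k i.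
      have [ij|ji] := leqP i j.
        apply: eigenM; last exact: IH.
        rewrite Lminus_inv_entries //; case: eqP => [->|_]; last exact: eigen0.
        exact: eigen_Lplus.
      have -> : (if k == i then diag_eigen m k else 0) = 0 :> K.
        by rewrite ifN // -val_eqE /= ltn_eqF // (leq_ltn_trans kj).
      rewrite mul0r /eigen -scalerA (IH _ _ ki) ifN; last first.
        by rewrite -val_eqE /= ltn_eqF // (leq_ltn_trans kj).
      by rewrite !scale0r scaler0.
    have ij : (i < j)%N by apply: leq_trans ik kj.
    rewrite Lminus_inv_entries ?(ltnW ij) // -val_eqE /= (ltn_eqF ij) mul0r.
    by rewrite mulr0; apply: eigen0.
  apply: eigenZ; apply: eigenM.
    rewrite Lminus_inv_entries //; case: eqP => [->|_]; last exact: eigen0.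
    exact: eigen_Lplus.
  by have := IH i i (leqnn i); rewrite eqxx.
have -> : (if k == j then diag_eigen m.+1 k else 0)
    = (t j)^-1 * (if k == j then t k * diag_eigen m.+1 k else 0).
  by case: eqP => [->|_]; rewrite ?mulr0 // mulKf.
rewrite exprSr [_ * M]mulmxA mxE /eigen scaler_suml (bigD1 j) //= big1.
  by rewrite addr0; apply: eigenM => //; apply: eigen_Lplus.
move=> l lj; rewrite -scalerA; have [llj|jl|e] := ltngtP l j.
- by rewrite Lp_xi // scaler0.
- by rewrite Lp0 // scale0r scaler0.
- by rewrite -val_eqE /= e eqxx in lj.
Qed.

(** The numbers [c k * diag_eigen m k] satisfy the recursion of
    [gelfand_sum_rec] with [y k = q^(2 k + 2 - 2 n) t_k^-2], where [k] starts
    at 0. *)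
Lemma eigen_trace m :
  eigen (\sum_k c k *: (M ^+ m) k k)
    (gelfand_sum q q^-1 [seq q ^ ((2 * k.+1)%:Z - (2 * n)%:Z) * t k ^- 2
                 | k : 'I_n <- enum 'I_n] m).
Proof.
rewrite -[X in eigen _ X]mul1r.
rewrite -(@gelfand_sum_rec _ _ _ _ _ _ (fun m k => c k * diag_eigen m k)).
- apply: eigen_sum => k; apply: eigenZ.
  by have := eigen_M_exp m (leqnn k); rewrite eqxx.
- by rewrite divff.
- move=> k; rewrite mulr1 mul1r /c qdimV exprVn exprnN exprnP -expfzDr //.
  by congr (_ ^ _); rewrite -subzn //; ring.
move=> {}m k /=.
have -> : q ^ ((2 * k.+1)%:Z - (2 * n)%:Z) = q * c k * (q ^+ n)^-1.
  rewrite /c qdimV -[X in X * _ * _]expr1z exprnN -!expfzDr //.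
  by congr (_ ^ _); rewrite mulnS !PoszD; ring.
rewrite /h; field.
by rewrite q0 t0 expf_neq0.
Qed.

End HighestWeightVector.

(** * Traces, powers of q, and the theorem *)

Section WeightedTrace.
Variables (K : fieldType) (A : algType K) (n : nat) (q : K).
Hypothesis q0 : q != 0.

Lemma tr_diag (d : 'rV[K]_n) (X : 'M[A]_n) :
  \tr (map_mx (in_alg A) (diag_mx d) *m X) = \sum_i d 0 i *: X i i.
Proof.
apply: eq_bigr => i _; rewrite mxE (bigD1 i) //= big1 => [|j ji].
  by rewrite addr0 !mxE eqxx mulr1n /= -scalerAl mul1r.
by rewrite !mxE eq_sym (negPf ji) /= scale0r mul0r.
Qed.

Lemma Dmatrix_inv : invmx (Dmatrix n q) = diag_mx (\row_i (qdim q i)^-1).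
Proof.
have DD : Dmatrix n q *m diag_mx (\row_i (qdim q i)^-1) = 1%:M.
  rewrite mulmx_diag; apply/matrixP=> i j; rewrite !mxE.
  by case: eqP => [->|_]; rewrite ?mulr0n // mulfV // expfz_neq0.
have [uD _] := mulmx1_unit DD.
by rewrite -[LHS]mulmx1 -DD mulmxA mulVmx // mul1mx.
Qed.

Lemma tr_Dmatrix (X : 'M[A]_n) :
  \tr (map_mx (in_alg A) (Dmatrix n q) *m X) = \sum_i qdim q i *: X i i.
Proof. by rewrite tr_diag; apply: eq_bigr => i _; rewrite mxE. Qed.

Lemma tr_Dmatrix_inv (X : 'M[A]_n) :
  \tr (map_mx (in_alg A) (invmx (Dmatrix n q)) *m X)
  = \sum_i (qdim q i)^-1 *: X i i.
Proof.
by rewrite Dmatrix_inv tr_diag; apply: eq_bigr => i _; rewrite mxE.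
Qed.

End WeightedTrace.

Section QPower.
Variables (R : realType) (q logq : R[i]).
Hypothesis q_exp : cexp logq = q.

Lemma cexpD (z w : R[i]) : cexp (z + w) = cexp z * cexp w.
Proof.
case: z w => [a b] [c d]; rewrite /cexp /= expRD cosD sinD rmorphM /=.
rewrite [RHS]mulrACA; congr (_ * _); apply/eqP.
by rewrite eq_complex /= [X in _ && (X == _)]addrC !eqxx.
Qed.

Lemma qpowD a b : qpow logq (a + b) = qpow logq a * qpow logq b.
Proof. by rewrite /qpow rmorphD mulrDl cexpD. Qed.

Lemma qpow0 : qpow logq 0 = 1.
Proof.
rewrite /qpow rmorph0 mul0r /cexp /= expR0 cos0 sin0 rmorph1 mul1r.
by [].
Qed.

Lemma qpow1 : qpow logq 1 = q.
Proof. by rewrite /qpow rmorph1 mul1r. Qed.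

Lemma qpow_mulV a : qpow logq a * qpow logq (- a) = 1.
Proof. by rewrite -qpowD subrr qpow0. Qed.

Lemma qpow_neq0 a : qpow logq a != 0.
Proof.
by apply/eqP=> e; have /eqP := qpow_mulV a; rewrite e mul0r eq_sym oner_eq0.
Qed.

Lemma qpowN a : qpow logq (- a) = (qpow logq a)^-1.
Proof. by apply: (mulfI (qpow_neq0 a)); rewrite qpow_mulV divff ?qpow_neq0. Qed.

Lemma qpowMn a m : qpow logq (a * m%:R) = qpow logq a ^+ m.
Proof.
elim: m => [|m IH]; first by rewrite mulr0 qpow0.
by rewrite -natr1 mulrDr mulr1 qpowD IH exprSr.
Qed.

Lemma qpow_nat m : qpow logq m%:R = q ^+ m.
Proof. by rewrite -[m%:R]mul1r qpowMn qpow1. Qed.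

Lemma qpowN2 a : qpow logq (- 2 * a) = (qpow logq a) ^- 2.
Proof. by rewrite mulrC mulrN qpowN qpowMn. Qed.

Hypotheses (q0 : q != 0) (q21 : q ^+ 2 != 1).

(** Numerator and denominator are multiplied by [q^(- a - b)] times a common
    factor. *)
Lemma qnum_factor a b : qpow logq (- 2 * a) != qpow logq (- 2 * b) ->
  qnum q logq (a - b + 1) / qnum q logq (a - b) =
  (q^-1 * qpow logq (- 2 * a) - q * qpow logq (- 2 * b))
  / (qpow logq (- 2 * a) - qpow logq (- 2 * b)).
Proof.
have h0 : q * q - 1 != 0 by rewrite subr_eq0 -expr2.
rewrite /qnum !qpowN2 !(qpowN, qpowD) qpow1.
have := qpow_neq0 a; have := qpow_neq0 b.
move: (qpow logq a) (qpow logq b) => u v v0 u0; rewrite -subr_eq0 => uv.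
have uv' : v * v - u * u != 0.
  apply: contraNneq uv => e.
  have -> : u ^- 2 - v ^- 2 = (v * v - u * u) / (u * u * v * v).
    by field; rewrite u0 v0.
  by rewrite e mul0r.
have uv'' : u * u - v * v != 0 by rewrite -oppr_eq0 opprB.
by field; rewrite v0 u0 q0 h0 mulN1r mulNr uv'' !expr2 uv'.
Qed.

End QPower.

Definition gelfand_poly n (K : fieldType) (q : K) (m : nat) : mpoly n K :=
  gelfand_sum (mpolyC n q) (mpolyC n q^-1)
    [seq mpolyX K (mnm1 i) | i <- enum 'I_n] m.

Lemma meval_gelfand_poly n (K : fieldType) (q : K) m (y : 'I_n -> K) :
  meval y (gelfand_poly n q m) = gelfand_sum q q^-1 [seq y i | i <- enum 'I_n] m.
Proof.
rewrite /gelfand_poly (gelfand_sum_rmorph (meval y)) /= !mevalC -map_comp.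
by congr gelfand_sum; apply: eq_map => i /=; rewrite mevalXU.
Qed.

(** A permutation of the variables only reorders the list. *)
Lemma gelfand_poly_sym n (K : fieldType) (q : K) m : q != 0 ->
  gelfand_poly n q m \is @symmetric n K.
Proof.
move=> q0; apply/issymP => s.
rewrite /gelfand_poly (gelfand_sum_rmorph (msym s)) /= /msym !mmapC -map_comp.
apply: gelfand_sum_perm; first by rewrite -rmorphM divff // rmorph1.
rewrite (eq_map (g := (fun i => mpolyX K (mnm1 i)) \o fun_of_perm s)); last first.
  by move=> i /=; rewrite mmapX mmap1U.
rewrite map_comp; apply: perm_map; apply: uniq_perm.
- by rewrite map_inj_uniq ?enum_uniq //; apply: perm_inj.
- exact: enum_uniq.
move=> i; rewrite mem_enum; apply/mapP; exists (s^-1 i)%g.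
  by rewrite mem_enum.
by rewrite permKV.
Qed.

Lemma gelfand_polyP (R : realType) n m (q : R[i]) :
  q != 0 -> is_gelfand_poly q m (gelfand_poly n q m).
Proof.
move=> q0; split=> [|z zinj]; first exact: gelfand_poly_sym.
by rewrite meval_gelfand_poly -gelfand_sum_formula.
Qed.

(** Nonvanishing of the q-numbers in the denominators makes the points
    [q^(-2 l_i)] distinct, and there the polynomial is given by the
    formula. *)
Lemma gelfand_eigenvalueE (R : realType) n m (q logq : R[i]) P
    (l : 'I_n -> R) : cexp logq = q -> q != 0 -> q ^+ 2 != 1 ->
  is_gelfand_poly q m P ->
  gelfand_eigenvalue q logq m P l = meval (fun i => qpow logq (- 2 * l i)) P.
Proof.
move=> q_exp q0 q21 [_ PE]; rewrite /gelfand_eigenvalue.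
case: forallP => // l_sep.
have yinj : injective (fun i => qpow logq (- 2 * l i)).
  move=> i k; rewrite !qpowN2 => /invr_inj yik.
  apply/eqP/negPn/negP=> ik.
  have := forallP (l_sep k) i; rewrite ik /= => /eqP; apply.
  rewrite /qnum opprB !qpowD !qpowN.
  have -> : qpow logq (l i) / qpow logq (l k)
        - qpow logq (l k) / qpow logq (l i)
      = (qpow logq (l i) ^+ 2 - qpow logq (l k) ^+ 2)
        / (qpow logq (l i) * qpow logq (l k)).
    by field; rewrite !qpow_neq0.
  by rewrite yik subrr !mul0r.
rewrite PE //; apply: eq_bigr => k _; rewrite qpowMn; congr (_ * _).
apply: eq_bigr => i ik; apply: qnum_factor => //.
by rewrite (inj_eq yinj).
Qed.

Lemma qpow_ell (R : realType) n (q logq : R[i]) (lam : 'I_n -> R) (i : 'I_n) :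
  cexp logq = q ->
  q ^ ((2 * i.+1)%:Z - (2 * n)%:Z) * qpow logq (lam i) ^- 2
  = qpow logq (- 2 * ell lam i).
Proof.
move=> q_exp; rewrite qpowN2 /ell qpowD (qpow_nat q_exp).
rewrite [(_ * q ^+ _) ^+ 2]exprMn [in RHS]invfM [LHS]mulrC.
congr (_ * _); rewrite -exprM exprnN; congr (_ ^ _).
by rewrite !PoszM -subzn //; ring.
Qed.

Theorem mainTheorem3 (R : realType) (n : nat) (q logq : R[i])
    (q_neq0 : q != 0) (q_nroot : forall k : nat, (0 < k)%N -> q ^+ k != 1)
    (q_exp : cexp logq = q) (m : nat) :
  let U := Uq n q in
  let Lp : 'M[U]_n := Lplus n q in
  let Lm : 'M[U]_n := Lminus n q in
  let D : 'M[U]_n := map_mx (in_alg U) (Dmatrix n q) in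
  let Dinv : 'M[U]_n := map_mx (in_alg U) (invmx (Dmatrix n q)) in
  let central (z : U) := forall u : U, z * u = u * z in
  [/\ central (\tr (Dinv *m (mxinv Lp *m Lm) ^+ m)),
      central (\tr (Dinv *m (mxinv Lm *m Lp) ^+ m)),
      central (\tr (D *m (Lp *m mxinv Lm) ^+ m)),
      \tr (Dinv *m (mxinv Lp *m Lm) ^+ m) = \tr (D *m (Lm *m mxinv Lp) ^+ m) &
      \tr (Dinv *m (mxinv Lm *m Lp) ^+ m) = \tr (D *m (Lp *m mxinv Lm) ^+ m)]
  /\ exists P : mpoly n R[i], is_gelfand_poly q m P /\
     forall (lam : 'I_n -> R) (V : lmodType U) (xi : V),
       is_Lq logq lam xi ->
       forall v : V, \tr (D *m (Lp *m mxinv Lm) ^+ m) *: v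
                     = ((gelfand_eigenvalue q logq m P (ell lam))%:A : U) *: v.
Proof.
move=> U Lp Lm D Dinv central.
have [LpK LpV] := Lplus_inv n q; have [LmK LmV] := Lminus_inv n q.
pose B : 'M[U]_(n * n) := braid U q (q - q^-1) (fun i k => (i < k)%N).
pose S : 'M[U]_(n * n) := braid U q^-1 (- (q - q^-1)) (fun i k => (k < i)%N).
have RLpLp : B *m tens1 Lp *m tens2 Lp = tens2 Lp *m tens1 Lp *m B.
  exact: (@Uq_RLL _ n q true true).
have RLmLm : B *m tens1 Lm *m tens2 Lm = tens2 Lm *m tens1 Lm *m B.
  exact: (@Uq_RLL _ n q false false).
have RLpLm : B *m tens1 Lp *m tens2 Lm = tens2 Lm *m tens1 Lp *m B.
  exact: (@Uq_RLL _ n q true false).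
pose M := mxinv Lm *m Lp; pose M' := mxinv Lp *m Lm.
have MLp := tens2_comm_exp m (comm_M_Lplus LmK LmV RLpLp RLpLm).
have MLm k := tens2_comm_exp k (comm_M_Lminus q_neq0 LmK LmV RLmLm RLpLm).
have M'Lp := tens2_comm_exp m (comm_Minv_Lplus LpK LpV LmK LmV RLpLp RLpLm).
have M'Lm := tens2_comm_exp m
  (comm_Minv_Lminus q_neq0 LpK LpV LmK LmV RLmLm RLpLm).
have trC X : tens2 X *m (tens1 Lp *m B) = tens1 Lp *m B *m tens2 X ->
    tens2 X *m (tens1 Lm *m S) = tens1 Lm *m S *m tens2 X ->
    central (\tr (Dinv *m X)).
  move=> XLp XLm; rewrite /central (tr_Dmatrix_inv q_neq0).
  apply: Uq_gen_central => s i j.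
  have [zLp zLm] := trace_central q_neq0 XLp XLm i j.
  by case: s.
have trM' : \tr (Dinv *m M' ^+ m) = \tr (D *m (Lm *m mxinv Lp) ^+ m).
  rewrite (tr_Dmatrix_inv q_neq0) tr_Dmatrix; apply/esym.
  exact: (trace_exp_Minv q_neq0 LpK LpV LmK LmV RLpLp RLpLm).
have trM : \tr (Dinv *m M ^+ m) = \tr (D *m (Lp *m mxinv Lm) ^+ m).
  rewrite (tr_Dmatrix_inv q_neq0) tr_Dmatrix; apply/esym.
  exact: (trace_exp_M q_neq0 LmK LmV RLmLm RLpLm).
have cM := trC _ MLp (MLm m); have cM' := trC _ M'Lp M'Lm.
split.
  split; [exact: cM' | exact: cM | rewrite -trM; exact: cM | exact: trM' |].
  exact: trM.
have q21 : q ^+ 2 != 1 by apply: q_nroot.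
have polyE := gelfand_polyP n m q_neq0.
exists (gelfand_poly n q m); split; first exact: polyE.
move=> lam V xi [xi0 Lp_xi Lm_xi gen _] v.
have [u ->] := gen v.
rewrite -trM (gelfand_eigenvalueE _ q_exp q_neq0 q21 polyE).
have -> : \tr (Dinv *m M ^+ m) *: (u *: xi) = u *: (\tr (Dinv *m M ^+ m) *: xi).
  by rewrite !scalerA cM.
rewrite -scalar_act; congr (_ *: _).
have t0 i : qpow logq (lam i) != 0 by apply: qpow_neq0.
have Lp0 (i j : 'I_n) : (j < i)%N -> Lp i j = 0.
  by move=> ij; rewrite mxE [free_L _ _ _ _ _]mxE; apply/Uq_rel0/rel_plus.
have Lm0 (i j : 'I_n) : (i < j)%N -> Lm i j = 0.
  by move=> ij; rewrite mxE [free_L _ _ _ _ _]mxE; apply/Uq_rel0/rel_minus.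
have LpLm i : Lp i i * Lm i i = 1 by rewrite !mxE; apply: (Uq_diag q true).
have Mexch k i j := mulmx_Lminus_inv q_neq0 LmK LmV i j (MLm k).
have := eigen_trace q_neq0 t0 LmK Lm0 Lp0 LpLm Lp_xi Lm_xi Mexch m.
rewrite /eigen (tr_Dmatrix_inv q_neq0) => ->; congr (_%:A *: _).
rewrite meval_gelfand_poly; congr (gelfand_sum _ _ _ _); apply: eq_map => i.
exact: qpow_ell.
Qed.
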